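(* Let $0<\delta_0<1$ be fixed. There exist $\lambda_0>0$ and a function $\alpha:(0,\lambda_0)\to(0,1]$ (depending only on $\delta_0$) with $\alpha(\lambda)\to 1$ as $\lambda\to 0$, such that for every $\lambda\in(0,\lambda_0)$ and every real $E$ with $\delta_0<|E|<2-\delta_0$, the Furstenberg measure $\nu_E^{(\lambda)}$ of the Anderson–Bernoulli model satisfies $$\dim \nu_E^{(\lambda)}\ \ge\ \alpha(\lambda).$$
   Context: Anderson–Bernoulli model: $H_\lambda=\Delta+\lambda V$ on $\mathbb Z$, where $\Delta$ is the lattice Laplacian $(\Delta u)_n=u_{n-1}+u_{n+1}$ and $(V u)_n=\varepsilon_n u_n$, with $(\varepsilon_n)_{n\in\mathbb Z}$ independent random variables taking the values $1$ and $-1$ with probability $\tfrac12$ each; $\lambda>0$ is the disorder. For a real energy $E$ let $\mu=\mu_{E,\lambda}$ be the probability measure on $SL_2(\mathbb R)$ $$\mu=\tfrac12\,\delta_{g_-}+\tfrac12\,\delta_{g_+},\qquad g_{\mp}=\begin{pmatrix}E\mp\lambda&-1\\1&0\end{pmatrix}.$$ The group $SL_2(\mathbb R)$ acts projectively on $P_1(\mathbb R)$, identified with the circle $\mathbb T$ of angles $\theta$ modulo $\pi$ (the angle $\theta$ representing the line spanned by $(\cos\theta,\sin\theta)$): for $g=\begin{pmatrix}a&b\\c&d\end{pmatrix}$, $\tau_g(\theta)$ is the angle of the vector $(a\cos\theta+b\sin\theta,\ c\cos\theta+d\sin\theta)$. The Furstenberg measure $\nu_E^{(\lambda)}$ is the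 unique $\mu$-stationary probability measure on $P_1(\mathbb R)\simeq\mathbb T$, i.e. $\nu=\int(\tau_g)_*[\nu]\,\mu(dg)$. The dimension $\dim\nu$ of a probability measure $\nu$ on $\mathbb T$ is the supremum of the $\alpha\ge0$ for which there is a constant $C$ with $\nu(I)\le C|I|^{\alpha}$ for all intervals (arcs) $I\subset\mathbb T$. *)

(* Defs.v *)
From HB Require Import structures.
From mathcomp Require Import all_boot all_order all_algebra.
From mathcomp Require Import all_classical all_reals all_analysis.
From mathcomp Require Import measurable_realfun ring lra.

Set Implicit Arguments.
Unset Strict Implicit.
Unset Printing Implicit Defensive.

Import Order.TTheory GRing.Theory Num.Theory.
Import numFieldNormedType.Exports.

Local Open Scope classical_set_scope.
Local Open Scope ring_scope.

(* The circle of angles modulo pi, i.e. the real projective line, is represented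
   by the fundamental domain [0, pi[; a probability measure on it is a Borel
   probability measure on R giving mass 1 to [0, pi[. *)
Definition circle (R : realType) : set R := `[0, pi[%classic.
Arguments circle : clear implicits.

Definition circle_proj (R : realType) (x : R) : R :=
  x - (Num.floor (x / pi))%:~R * pi.

Definition line_vec (R : realType) (t : R) : 'cV[R]_2 :=
  \col_i (if i == 0 then cos t else sin t).

(* For v 1 0 != 0 the angle is the value in ]0, pi[ of the inverse cotangent of
   v 0 0 / v 1 0; see line_angleP. *)
Definition line_angle (R : realType) (v : 'cV[R]_2) : R :=
  if v 1 0 == 0 then 0 else pi / 2 - atan (v 0 0 / v 1 0).

Definition proj_act (R : realType) (g : 'M[R]_2) (t : R) : R :=
  line_angle (g *m line_vec t).

Definition transfer_mx (R : realType) (x : R) : 'M[R]_2 :=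
  \matrix_(i, j) nth 0 (nth [::] [:: [:: x; -1]; [:: 1; 0]] i) j.

(* A finitely supported law on 'M_2 is the list of its weighted atoms (w, g),
   standing for the sum of the w *: \d_g. *)
Definition anderson_bernoulli_law (R : realType) (E lambda : R) :
    seq (R * 'M[R]_2) :=
  [:: (1 / 2, transfer_mx (E - lambda)); (1 / 2, transfer_mx (E + lambda))].

(* For a finitely supported law the integral over g is a finite sum. *)
Definition stationary (R : realType) (mu : seq (R * 'M[R]_2))
    (nu : probability (measurableTypeR R) R) : Prop :=
  nu (circle R) = 1%E /\
  forall A : set (measurableTypeR R), measurable A ->
    nu A = (\sum_(wg <- mu) wg.1%:E * pushforward nu (proj_act wg.2) A)%E.

(* Existence and uniqueness of the stationary probability measure are
   Furstenberg's theorem and are not part of the predicate. *)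
Definition furstenberg_measure (R : realType) (E lambda : R)
    (nu : probability (measurableTypeR R) R) : Prop :=
  stationary (anderson_bernoulli_law E lambda) nu.

Definition is_arc (R : realType) (I : set R) : Prop :=
  exists J : set R, is_interval J /\ I = @circle_proj R @` J.

(* The length of an arc is its Lebesgue measure inside [0, pi[.  The supremum is
   taken in \bar R; the exponent 0 is always admissible. *)
Definition measure_dim (R : realType) (nu : probability (measurableTypeR R) R) :
    \bar R :=
  ereal_sup [set a%:E | a in [set a : R | 0 <= a /\
    exists C : R, forall I : set R, is_arc I ->
      (nu I <= C%:E * (@lebesgue_measure R I) `^ a)%E]].

Lemma circle_proj_in (R : realType) (x : R) : circle R (circle_proj x).
Proof.
have p0 := @pi_gt0 R.
rewrite /circle /circle_proj /= in_itv /= subr_ge0 ltrBlDr.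
rewrite -ler_pdivlMr // floor_le /=.
have := floorD1_gt (x / pi); rewrite intrD ltr_pdivrMr //.
by rewrite mulrDl mul1r addrC.
Qed.

Lemma line_angleP (R : realType) (v : 'cV[R]_2) : v != 0 ->
  circle R (line_angle v) /\
  exists2 r : R, r != 0 & v = r *: line_vec (line_angle v).
Proof.
move=> v0; have p0 := @pi_gt0 R; rewrite /circle /line_angle /= in_itv /=.
have vE r t : v 0 0 = r * cos t -> v 1 0 = r * sin t -> v = r *: line_vec t.
  move=> h0 h1; apply/matrixP => i j; rewrite (ord1 j) !mxE.
  case: i => [[|[|//]]] hi /=; last first.
    by rewrite -h1; congr (v _ _); exact: val_inj.
  by rewrite -h0; congr (v _ _); exact: val_inj.
case: eqP => [v1|/eqP v1].
  split; first by rewrite lexx p0.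
  exists (v 0 0); last by apply: vE; rewrite ?cos0 ?sin0 ?mulr1 ?mulr0.
  apply: contra_neq v0 => v00; rewrite (vE 0 0) ?scale0r ?mul0r //.
set a := atan _; have := atan_ltpi2 (v 0 0 / v 1 0).
have := atan_gtNpi2 (v 0 0 / v 1 0); rewrite -/a => h1 h2.
split; first by apply/andP; split; lra.
have ca0 : cos a != 0 by rewrite gt_eqF // cos_gt0_pihalf // h1 h2.
have tanE : sin a / cos a = v 0 0 / v 1 0 by rewrite -[RHS]atanK.
exists (v 1 0 / cos a); first by rewrite mulf_neq0 // invr_eq0.
apply: vE.
  rewrite cosB cos_pihalf sin_pihalf mul0r add0r mul1r.
  by rewrite mulrAC -mulrA tanE mulrC divfK.
by rewrite sinB cos_pihalf sin_pihalf mul1r mul0r subr0 divfK.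
Qed.

Lemma line_vec_inj (R : realType) (r s t : R) :
  circle R s -> circle R t -> line_vec s = r *: line_vec t -> s = t.
Proof.
rewrite /circle /= !in_itv /= => /andP[s0 sp] /andP[t0 tp] /matrixP h.
have := h 0 0; have := h 1 0; rewrite !mxE /= => hs hc.
have st0 : sin (s - t) = 0 by rewrite sinB hs hc; ring.
case: (ltgtP s t) => // lt_st.
- have : 0 < sin (t - s) by apply: sin_gt0_pi; apply/andP; split; lra.
  by rewrite -opprB sinN st0 oppr0 ltxx.
- have : 0 < sin (s - t) by apply: sin_gt0_pi; apply/andP; split; lra.
  by rewrite st0 ltxx.
Qed.

Lemma det_transfer_mx (R : realType) (x : R) : \det (transfer_mx x) = 1.
Proof.
rewrite (expand_det_row _ 0) big_ord_recl big_ord1 /cofactor !det_mx11 !mxE /=.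
rewrite [bump 0 0]/= !add0n expr0 expr1; ring.
Qed.

Lemma measurable_invr (R : realType) :
  measurable_fun setT (GRing.inv : R -> R).
Proof.
have o : open [set x : R | x != 0] by exact: open_neq.
rewrite -(setUv [set x : R | x != 0]).
have m0 : measurable [set x : R | x != 0] by exact: open_measurable.
apply/measurable_funU => //; first exact: measurableC.
split.
  apply: open_continuous_measurable_fun => // x; rewrite inE /= => x0.
  exact: inv_continuous.
apply: (@eq_measurable_fun _ _ _ _ _ (cst (0 : R)));
  last exact: measurable_cst.
by move=> x; rewrite inE /= => /negP; rewrite negbK => /eqP ->; rewrite invr0.
Qed.

Lemma measurable_proj_act (R : realType) (g : 'M[R]_2) :
  measurable_fun setT (proj_act g : R -> R).
Proof.
have mv i : measurable_fun setT (fun t : R => (g *m line_vec t) i 0 : R).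
  under eq_fun do rewrite mxE big_ord_recl big_ord1 !mxE /=.
  apply: measurable_funD; apply: measurable_funM => //;
    apply: continuous_measurable_fun;
    [exact: continuous_cos|exact: continuous_sin].
rewrite /proj_act /line_angle.
apply: measurable_fun_ifT => //=.
  exact: (@measurable_fun_eqr _ _ _ _ _ (cst 0) (mv 1)).
apply: measurable_funB => //.
apply: (measurableT_comp (f := @atan R)).
  by apply: continuous_measurable_fun => x; exact: continuous_atan.
apply: measurable_funM; first exact: mv.
exact: (measurableT_comp (@measurable_invr R) (mv 1)).
Qed.

(* Main.v *)
Require Import Defs.
From HB Require Import structures.
From mathcomp Require Import all_boot all_order all_algebra.
From mathcomp Require Import all_classical all_reals all_analysis.
From mathcomp Require Import finmap measurable_realfun ring lra.

Set Implicit Arguments.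
Unset Strict Implicit.
Unset Printing Implicit Defensive.

Import Order.TTheory GRing.Theory Num.Theory.
Import numFieldNormedType.Exports.

Local Open Scope classical_set_scope.
Local Open Scope ring_scope.

(** By stationarity the mass of an arc is the mean of the masses of its images
    under the two inverse transfer matrices [g^-1].  Suppose that a positive
    function [Z] of arcs satisfies [E Z (g^-1 I) <= (1 - gamma) * Z I] and is
    bounded below by [z0] on the arcs that are not short.  Comparing [nu I] with
    [Z I / z0 + h], a supremum of the quotient larger than 1 could only be
    approached along arcs shrinking to a point; as [nu] has no atoms, this gives
    [nu I <= Z I / z0].

    For the arc spanned by two vectors [v] and [v'] we take
    [Z = |det (v, v')|^al * sqrt (F v * F v')] where [F] is homogeneous of degree
    [- 2 * al] and [E F (g^-1 v) <= (1 - gamma) * F v]: the determinant is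
    invariant and Cauchy-Schwarz handles the product, so that [Z I] is comparable
    to [|I|^al].

    In the coordinates where the unperturbed transfer matrix is a rotation, [g^-1]
    is this rotation followed by a shear of parameter [+- e], with [e] of order
    [lambda].  With [F = N^(- al) * (1 + e^2 * q)], where [N] is the squared norm,
    the trigonometric polynomial [q] is chosen by solving a cohomological equation
    over the rotation so as to cancel the oscillating part of the term of order
    [e^2]; this needs [E != 0] and [|E| < 2].  What remains is a constant of order
    [- (1 - al) * e^2] and an error [O(e^3)], so that [al = 1 - C * lambda] works. *)

(** * Elementary inequalities for powers and square roots *)

(** Bernoulli's inequality, as the case of Young's inequality with conjugate exponents [t^-1] and
    [(1 - t)^-1] in which the second factor is 1. *)
Lemma powR_le1D (R : realType) (x t : R) : 0 <= x -> 0 < t < 1 ->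
  x `^ t <= 1 + t * (x - 1).
Proof.
move=> x0 /andP[t0 t1].
have := @conjugate_powR R (x `^ t) 1 t^-1 (1 - t)^-1.
rewrite powR_ge0 ler01 !invr_gt0 t0 subr_gt0 t1 !invrK mulr1 -powRrM.
rewrite mulfV ?gt_eqF // powRr1 // powR1 => /(_ isT isT isT isT).
have -> : t + (1 - t) = 1 by ring.
by move=> /(_ erefl); lra.
Qed.

(** The square of this Taylor polynomial exceeds [1 + u] by [u ^+ 4] times a quadratic that is
    positive on the given range. *)
Lemma sqrt1D_le (R : realType) (u : R) : `|u| <= 1 ->
  Num.sqrt (1 + u) <= 1 + u / 2 - u ^+ 2 / 8 + u ^+ 3 / 16.
Proof.
rewrite ler_norml => /andP[u1 u2].
have h0 : 0 <= 1 + u / 2 - u ^+ 2 / 8 + u ^+ 3 / 16 by nra.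
rewrite -(ler_pXn2r (n := 2)) ?nnegrE ?sqrtr_ge0 // sqr_sqrtr; last by lra.
rewrite -subr_ge0.
have -> : (1 + u / 2 - u ^+ 2 / 8 + u ^+ 3 / 16) ^+ 2 - (1 + u) =
  u ^+ 4 * ((5/64) - u / 64 + u ^+ 2 / 256) by field.
by apply: mulr_ge0; [rewrite exprn_even_ge0 | nra].
Qed.

(* The exact quadratic Taylor coefficient is [(1 - eta) * (1 - eta / 2)]; all that
   matters is that the one below is less than [1 - eta], the coefficient that
   Bernoulli's inequality yields and for which the spectral gap would vanish. *)
Lemma powRN_le (R : realType) (u eta : R) : `|u| <= 1 / 4 -> 0 < eta < 1 / 2 ->
  (1 + u) `^ (- (1 - eta)) <=
    1 - (1 - eta) * u + (1 - eta - eta / 4) * u ^+ 2 + 2 * `|u| ^+ 3.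
Proof.
move=> hu /andP[e0 e1].
have /andP[u1 u2] : - (1 / 4) <= u <= 1 / 4 by rewrite -ler_norml.
have up : 0 < 1 + u by lra.
have -> : - (1 - eta) = eta - 1 by ring.
rewrite powRB; last by rewrite (gt_eqF up) implybT.
rewrite powRr1 ?(ltW up) // ler_pdivrMr //.
(* Bernoulli's inequality is applied to the square root with exponent [2 * eta]: the quadratic term
   [- u ^+ 2 / 8] of the root then yields the gain [- eta / 4]. *)
have {1}-> : eta = 2^-1 * (2 * eta) by field.
rewrite powRrM powR12_sqrt ?(ltW up) //.
apply: le_trans (powR_le1D _ _) _; rewrite ?sqrtr_ge0 //.
  by apply/andP; split; lra.
have s0 : Num.sqrt (1 + u) <= 1 + u / 2 - u ^+ 2 / 8 + u ^+ 3 / 16.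
  by apply: sqrt1D_le; apply: le_trans hu _; lra.
have : 2 * eta * (Num.sqrt (1 + u) - 1) <=
       2 * eta * (u / 2 - u ^+ 2 / 8 + u ^+ 3 / 16).
  by apply: ler_wpM2l; lra.
move=> /(lerD (lexx 1)) /le_trans; apply.
rewrite -subr_ge0.
have u3 : u ^+ 3 <= `|u| ^+ 3 by rewrite -normrX ler_norm.
have u3' : - `|u| ^+ 3 <= u ^+ 3.
  by rewrite lerNl -normrX -normrN ler_norm.
have a0 : 0 <= `|u| ^+ 3 by rewrite exprn_ge0.
set a := `|u| ^+ 3 in u3 u3' a0 *.
have -> : (1 - (1 - eta) * u + (1 - eta - eta / 4) * u ^+ 2 + 2 * a) * (1 + u) -
  (1 + 2 * eta * (u / 2 - u ^+ 2 / 8 + u ^+ 3 / 16)) =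
  2 * a * (1 + u) + (1 - eta - eta / 4 - eta / 8) * u ^+ 3 by field.
nra.
Qed.

(** * The corrector and its cohomological equation *)

(* [C] and [S] stand for the cosine and sine of the doubled angle, [k1] and [k2]
   for the cotangents of the rotation angle and of its double. *)
Definition corrector (R : realType) (al be k1 k2 C S : R) : R :=
  al / 4 * (C - k1 * S) + be / 4 * (C ^+ 2 - S ^+ 2 - k2 * (2 * C * S)).

(* The corrector solves the cohomological equation over the rotation by the
   angle of cosine [c] and sine [s]; the frequencies 2 and 4 are not resonant
   because [s != 0] and [c != 0]. *)
Lemma corrector_rot (R : realType) (al be c s C S : R) :
  c ^+ 2 + s ^+ 2 = 1 -> c != 0 -> s != 0 ->
  let q := corrector al be (c / s) ((c ^+ 2 - s ^+ 2) / (2 * c * s)) in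
  q ((c ^+ 2 - s ^+ 2) * C - 2 * c * s * S)
    (2 * c * s * C + (c ^+ 2 - s ^+ 2) * S) =
  q C S - al / 2 * C - be / 2 * (C ^+ 2 - S ^+ 2).
Proof.
move=> cs c0 s0 q; rewrite /q /corrector.
have ecs : c * s * (c ^+ 2 + s ^+ 2) = c * s by rewrite cs mulr1.
have -> : c / s = c ^+ 2 / (c * s) by field; rewrite c0 s0.
have -> : (c ^+ 2 - s ^+ 2) / (2 * c * s) = (c ^+ 2 - s ^+ 2) / 2 / (c * s).
  by field; rewrite c0 s0.
have cs' : c ^+ 2 = 1 - s ^+ 2 by rewrite -cs; ring.
field: cs'; by rewrite c0 s0.
Qed.

Lemma ler_normM2 (R : realType) (a b x y : R) :
  `|a| <= x -> `|b| <= y -> `|a * b| <= x * y.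
Proof. by move=> ax bY; rewrite normrM ler_pM. Qed.

Lemma unit_circle_bounds (R : realType) (a b : R) : a ^+ 2 + b ^+ 2 = 1 ->
  [/\ `|a| <= 1, `|b| <= 1, `|a ^+ 2 - b ^+ 2| <= 1 & `|2 * a * b| <= 1].
Proof.
move=> ab; have a2 := sqr_ge0 a; have b2 := sqr_ge0 b.
have := sqr_ge0 (a - b); have := sqr_ge0 (a + b).
have -> : (a + b) ^+ 2 = a ^+ 2 + b ^+ 2 + 2 * (a * b) by ring.
have -> : (a - b) ^+ 2 = a ^+ 2 + b ^+ 2 - 2 * (a * b) by ring.
rewrite ab => h1 h2.
have n1 (x : R) : x ^+ 2 <= 1 -> `|x| <= 1.
  by rewrite -real_normK ?num_real // expr_le1.
split; [apply: n1|apply: n1|rewrite ler_norml; apply/andP; split..|].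
- lra.
- lra.
- lra.
- lra.
- by rewrite ler_norml -mulrA; apply/andP; split; lra.
Qed.

Lemma corrector_bound (R : realType) (al be k1 k2 K C S : R) :
  0 <= al <= 1 -> 0 <= be <= 1 -> 1 <= K -> `|k1| <= K -> `|k2| <= K ->
  C ^+ 2 + S ^+ 2 = 1 ->
  `|corrector al be k1 k2 C S| <= K.
Proof.
move=> al01 be01 K1 k1K k2K CS.
have [C1 S1 D1 T1] := unit_circle_bounds CS.
have h1 : `|C - k1 * S| <= 2 * K.
  apply: le_trans (ler_normB _ _) _.
  have := ler_normM2 k1K S1; lra.
have h2 : `|C ^+ 2 - S ^+ 2 - k2 * (2 * C * S)| <= 2 * K.
  apply: le_trans (ler_normB _ _) _.
  have := ler_normM2 k2K T1; lra.
have /andP[al0 al1] := al01; have /andP[be0 be1] := be01.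
have a1 : `|al / 4| <= 1 / 4 by rewrite ger0_norm; lra.
have b1 : `|be / 4| <= 1 / 4 by rewrite ger0_norm; lra.
apply: le_trans (ler_normD _ _) _.
have := ler_normM2 a1 h1; have := ler_normM2 b1 h2; lra.
Qed.

(** A shear of size [e] moves the doubled angle by [O(e)]. As the corrector carries a factor
    [e ^+ 2], evaluating it before the shear instead of after costs only [O(e ^+ 3)]. *)
Lemma corrector_lip (R : realType) (al be k1 k2 K d C S C' S' : R) :
  0 <= al <= 1 -> 0 <= be <= 1 -> 1 <= K -> `|k1| <= K -> `|k2| <= K ->
  C ^+ 2 + S ^+ 2 = 1 -> C' ^+ 2 + S' ^+ 2 = 1 ->
  `|C' - C| <= d -> `|S' - S| <= d ->
  `|corrector al be k1 k2 C' S' - corrector al be k1 k2 C S| <= 3 * K * d.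
Proof.
move=> al01 be01 K1 k1K k2K CS CS' dC dS.
have [C1 S1 _ _] := unit_circle_bounds CS.
have [C'1 S'1 _ _] := unit_circle_bounds CS'.
have CC : `|C' + C| <= 2 by apply: le_trans (ler_normD _ _) _; lra.
have SS : `|S' + S| <= 2 by apply: le_trans (ler_normD _ _) _; lra.
have d0 : 0 <= d by apply: le_trans dC.
have -> : corrector al be k1 k2 C' S' - corrector al be k1 k2 C S =
  al / 4 * ((C' - C) - k1 * (S' - S)) +
  be / 4 * ((C' + C) * (C' - C) - (S' + S) * (S' - S)
    - k2 * (2 * ((C' - C) * S' + C * (S' - S)))) by rewrite /corrector; ring.
have h1 : `|(C' - C) - k1 * (S' - S)| <= 2 * (K * d).
  apply: le_trans (ler_normB _ _) _.
  have := ler_normM2 k1K dS; nra.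
have h3 : `|2 * ((C' - C) * S' + C * (S' - S))| <= 4 * d.
  rewrite normrM ger0_norm; last by lra.
  have := ler_normM2 dC S'1; have := ler_normM2 C1 dS.
  have := ler_normD ((C' - C) * S') (C * (S' - S)); lra.
have h2 : `|(C' + C) * (C' - C) - (S' + S) * (S' - S)
    - k2 * (2 * ((C' - C) * S' + C * (S' - S)))| <= 8 * (K * d).
  apply: le_trans (ler_normB _ _) _.
  apply: le_trans (lerD (ler_normB _ _) (lexx _)) _.
  have := ler_normM2 k2K h3; have := ler_normM2 CC dC.
  have := ler_normM2 SS dS; nra.
have /andP[al0 al1] := al01; have /andP[be0 be1] := be01.
have a1 : `|al / 4| <= 1 / 4 by rewrite ger0_norm; lra.
have b1 : `|be / 4| <= 1 / 4 by rewrite ger0_norm; lra.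
apply: le_trans (ler_normD _ _) _.
have Kd : 0 <= K * d by apply: mulr_ge0 => //; lra.
have := ler_normM2 a1 h1; have := ler_normM2 b1 h2; lra.
Qed.

(** * Second-order expansion along a small shear *)

(** Here [1 + u] is the squared norm of the sheared unit vector [(x, z + t * x)], and [q] is
    evaluated at the cosine and sine of twice its angle. The power is expanded by [powRN_le] and the
    argument of [q] is moved back to [(x, z)]. *)
Lemma shear_term_le (R : realType) (eta k1 k2 K e t x z : R) :
  0 < eta < 1 / 2 -> 1 <= K -> `|k1| <= K -> `|k2| <= K ->
  0 < e <= 1 / 8 -> `|t| = e -> x ^+ 2 + z ^+ 2 = 1 ->
  let al := 1 - eta in let be := 1 - eta - eta / 4 in
  let u := 2 * t * x * z + t ^+ 2 * x ^+ 2 in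
  let q := corrector al be k1 k2 in
  e ^+ 2 * K <= 1 / 2 ->
  (1 + u) `^ (- al) *
    (1 + e ^+ 2 * q ((x ^+ 2 - (z + t * x) ^+ 2) / (1 + u))
                    (2 * x * (z + t * x) / (1 + u))) <=
  1 - al * u + be * u ^+ 2 + e ^+ 2 * q (x ^+ 2 - z ^+ 2) (2 * x * z)
    + 43 * K * e ^+ 3.
Proof.
move=> eta01 K1 k1K k2K /andP[e0 e8] te xz al be u q eK.
have /andP[eta0 eta1] := eta01.
have [x1 _ _ xz2] := unit_circle_bounds xz.
have tE : t ^+ 2 = e ^+ 2 by rewrite -te real_normK ?num_real.
have x2 : `|x ^+ 2| <= 1.
  by rewrite ger0_norm ?sqr_ge0 //; have := sqr_ge0 z; lra.
have ee : e ^+ 2 <= e / 8 by nra.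
have ule : `|u| <= 9 / 8 * e.
  have -> : u = t * (2 * x * z) + t ^+ 2 * x ^+ 2 by rewrite /u; ring.
  apply: le_trans (ler_normD _ _) _.
  have te' : `|t| <= e by rewrite te.
  have te2 : `|t ^+ 2| <= e ^+ 2 by rewrite tE ger0_norm // sqr_ge0.
  have := ler_normM2 te' xz2; have := ler_normM2 te2 x2; lra.
have u4 : `|u| <= 1 / 4 by apply: le_trans ule _; lra.
have /andP[u1 u2] : - (1 / 4) <= u <= 1 / 4 by rewrite -ler_norml.
have u0 : 0 < 1 + u by lra.
have un0 : 1 + u != 0 by rewrite gt_eqF.
have al01 : 0 <= al <= 1 by rewrite /al; lra.
have be01 : 0 <= be <= 1 by rewrite /be; lra.
set C' := _ / (1 + u); set S' := _ / (1 + u).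
set C := x ^+ 2 - _; set S := 2 * x * z.
have CS : C ^+ 2 + S ^+ 2 = 1.
  have -> : C ^+ 2 + S ^+ 2 = (x ^+ 2 + z ^+ 2) ^+ 2 by rewrite /C /S; ring.
  by rewrite xz expr1n.
have xz' : x ^+ 2 = 1 - z ^+ 2 by rewrite -xz; ring.
have uE : x ^+ 2 + (z + t * x) ^+ 2 = 1 + u by rewrite /u; ring: xz'.
have CS' : C' ^+ 2 + S' ^+ 2 = 1.
  have -> : C' ^+ 2 + S' ^+ 2 =
     ((x ^+ 2 + (z + t * x) ^+ 2) / (1 + u)) ^+ 2 by rewrite /C' /S'; ring.
  by rewrite uE divff // expr1n.
have [C1 _ _ _] := unit_circle_bounds CS.
have dC : `|C' - C| <= 5 * e.
  have -> : C' - C = - u * (1 + C) / (1 + u).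
    apply: (mulIf un0); rewrite mulrBl /C' !divfK // /C /u.
    by ring: xz'.
  rewrite normrM normfV (gtr0_norm u0) ler_pdivrMr // normrM normrN.
  have : `|1 + C| <= 2 by rewrite ler_norml; move: C1; rewrite ler_norml; lra.
  have := normr_ge0 u; nra.
have dS : `|S' - S| <= 5 * e.
  have -> : S' - S = (2 * t * x ^+ 2 - u * S) / (1 + u).
    by apply: (mulIf un0); rewrite mulrBl /S' !divfK // /S; ring.
  rewrite normrM normfV (gtr0_norm u0) ler_pdivrMr //.
  apply: le_trans (ler_normB _ _) _.
  have h1 : `|2 * t * x ^+ 2| <= 2 * e * 1.
    by apply: ler_normM2 => //; rewrite normrM te ger0_norm.
  have := ler_normM2 ule xz2; rewrite -/S => h2.
  nra.
have qd := corrector_lip al01 be01 K1 k1K k2K CS CS' dC dS.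
have qK := corrector_bound al01 be01 K1 k1K k2K CS'.
rewrite -/(q _ _) in qK; rewrite -/(q C' S') -/(q C S) in qd.
set Q' := q C' S' in qK qd *; set Q := q C S in qd *.
set P := 1 - al * u + be * u ^+ 2 + 2 * `|u| ^+ 3.
have pP : (1 + u) `^ (- al) <= P by exact: powRN_le.
have u3 : `|u| ^+ 3 <= 3 / 2 * e ^+ 3.
  apply: le_trans (_ : (9 / 8 * e) ^+ 3 <= _).
    by rewrite ler_pXn2r // nnegrE; nra.
  rewrite exprMn; apply: ler_wpM2r; first by rewrite exprn_ge0 // ltW.
  lra.
have usq : u ^+ 2 <= 2 * e ^+ 2.
  rewrite -real_normK ?num_real //.
  have := normr_ge0 u; nra.
have e30 : 0 <= e ^+ 3 by rewrite exprn_ge0 // ltW.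
have e3 : e ^+ 3 <= e / 64.
  have -> : e ^+ 3 = e * e ^+ 2 by ring.
  nra.
have P1 : `|P - 1| <= 3 * e.
  have -> : P - 1 = be * u ^+ 2 + 2 * `|u| ^+ 3 - al * u by rewrite /P; ring.
  have n3 : 0 <= `|u| ^+ 3 by rewrite exprn_ge0.
  have : `|al * u| <= 1 * (9 / 8 * e) by apply: ler_normM2; rewrite // ger0_norm; lra.
  have : 0 <= be * u ^+ 2 by apply: mulr_ge0; [lra|exact: sqr_ge0].
  have : be * u ^+ 2 <= 2 * e ^+ 2 by have := sqr_ge0 u; nra.
  rewrite !ler_norml => a1 a2 /andP[a3 a4]; apply/andP; split; lra.
have Q'0 : 0 <= 1 + e ^+ 2 * Q'.
  move: qK; rewrite ler_norml => /andP[? ?].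
  have := sqr_ge0 e; nra.
apply: le_trans (ler_wpM2r Q'0 pP) _.
have -> : P * (1 + e ^+ 2 * Q') = P + e ^+ 2 * Q + e ^+ 2 * ((P - 1) * Q' + (Q' - Q)) by ring.
have PQ := ler_normM2 P1 qK.
(* The variation of [P] contributes [3 * K * e], the Lipschitz bound on the corrector
   [3 * K * (5 * e)]. *)
have h : (P - 1) * Q' + (Q' - Q) <= 18 * K * e.
  apply: le_trans (ler_norm _) _; apply: le_trans (ler_normD _ _) _; lra.
have : e ^+ 2 * ((P - 1) * Q' + (Q' - Q)) <= e ^+ 2 * (18 * K * e).
  by apply: ler_wpM2l h; exact: sqr_ge0.
have -> : e ^+ 2 * (18 * K * e) = 18 * K * e ^+ 3 by ring.
have : e ^+ 3 <= K * e ^+ 3 by nra.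
rewrite /P; lra.
Qed.

(** The terms linear in [e] cancel between the two signs. Both [x ^+ 2] and [(2 * x * z) ^+ 2] have
    mean [1 / 2] over the circle, so the constant part at order [e ^+ 2] is
    [(be - al) / 2 = - eta / 8]. Half of this gain absorbs the error [O(K * e ^+ 3)]; the other half
    is kept. *)
Lemma shear_mean_le (R : realType) (eta k1 k2 K e x z : R) :
  0 < eta < 1 / 2 -> 1 <= K -> `|k1| <= K -> `|k2| <= K ->
  0 < e <= 1 / 8 -> x ^+ 2 + z ^+ 2 = 1 ->
  let al := 1 - eta in let be := 1 - eta - eta / 4 in
  let u t := 2 * t * x * z + t ^+ 2 * x ^+ 2 in
  let q := corrector al be k1 k2 in
  let f t := (1 + u t) `^ (- al) *
    (1 + e ^+ 2 * q ((x ^+ 2 - (z + t * x) ^+ 2) / (1 + u t))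
                    (2 * x * (z + t * x) / (1 + u t))) in
  e ^+ 2 * K <= 1 / 2 -> 1000 * K * e <= eta ->
  f e + f (- e) <= 2 * (1 - eta * e ^+ 2 / 16 +
    e ^+ 2 * (q (x ^+ 2 - z ^+ 2) (2 * x * z) - al / 2 * (x ^+ 2 - z ^+ 2)
      - be / 2 * ((x ^+ 2 - z ^+ 2) ^+ 2 - (2 * x * z) ^+ 2))).
Proof.
move=> eta01 K1 k1K k2K e01 xz al be u q f eK eKeta.
have /andP[e0 e8] := e01.
have h1 := shear_term_le eta01 K1 k1K k2K e01 (gtr0_norm e0) xz eK.
have Ne : `|- e| = e by rewrite normrN gtr0_norm.
have h2 := shear_term_le eta01 K1 k1K k2K e01 Ne xz eK.
rewrite -/al -/be -/q in h1 h2.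
rewrite -/(u e) -/(f e) in h1; rewrite -/(u (- e)) -/(f (- e)) in h2.
apply: le_trans (lerD h1 h2) _.
set Q := q _ _.
have uu : u e + u (- e) = 2 * e ^+ 2 * x ^+ 2 by rewrite /u; ring.
have uu2 : u e ^+ 2 + u (- e) ^+ 2 =
  2 * (e ^+ 2 * (2 * x * z) ^+ 2 + e ^+ 4 * x ^+ 4) by rewrite /u; ring.
have K3 : 1000 * K * e ^+ 3 <= eta * e ^+ 2.
  have -> : 1000 * K * e ^+ 3 = 1000 * K * e * e ^+ 2 by ring.
  by apply: ler_wpM2r => //; exact: sqr_ge0.
have e30 : 0 <= e ^+ 3 by rewrite exprn_ge0 // ltW.
have K31 : e ^+ 3 <= K * e ^+ 3 by nra.
have x4 : x ^+ 4 <= 1.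
  have x2 : x ^+ 2 <= 1 by have := sqr_ge0 z; lra.
  have -> : x ^+ 4 = x ^+ 2 * x ^+ 2 by ring.
  by rewrite -[leRHS]mulr1 ler_pM // sqr_ge0.
have x40 : 0 <= x ^+ 4 by rewrite exprn_even_ge0.
have e4 : e ^+ 4 <= e ^+ 3 * (1 / 8) by rewrite (exprSr e 3) ler_wpM2l.
have e40 : 0 <= e ^+ 4 by rewrite exprn_even_ge0.
have ex4 : be * (e ^+ 4 * x ^+ 4) <= e ^+ 3 / 8.
  have /andP[? ?] := eta01.
  apply: le_trans (_ : 1 * (e ^+ 4 * x ^+ 4) <= _).
    by apply: ler_wpM2r; [rewrite mulr_ge0 | rewrite /be; lra].
  rewrite mul1r; nra.
have z2 : z ^+ 2 = 1 - x ^+ 2 by rewrite -xz; ring.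
have -> : 1 - al * u e + be * u e ^+ 2 + e ^+ 2 * Q + 43 * K * e ^+ 3 +
  (1 - al * u (- e) + be * u (- e) ^+ 2 + e ^+ 2 * Q + 43 * K * e ^+ 3) =
  2 - al * (u e + u (- e)) + be * (u e ^+ 2 + u (- e) ^+ 2) + 2 * (e ^+ 2 * Q)
   + 86 * (K * e ^+ 3) by ring.
rewrite uu uu2.
rewrite -subr_ge0.
have -> : 2 * (1 - eta * e ^+ 2 / 16 +
    e ^+ 2 * (Q - al / 2 * (x ^+ 2 - z ^+ 2)
      - be / 2 * ((x ^+ 2 - z ^+ 2) ^+ 2 - (2 * x * z) ^+ 2))) -
  (2 - al * (2 * e ^+ 2 * x ^+ 2)
   + be * (2 * (e ^+ 2 * (2 * x * z) ^+ 2 + e ^+ 4 * x ^+ 4))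
   + 2 * (e ^+ 2 * Q) + 86 * (K * e ^+ 3)) =
  eta * e ^+ 2 / 8 - 86 * (K * e ^+ 3) - 2 * (be * (e ^+ 4 * x ^+ 4)).
  by rewrite /al /be; field: z2.
lra.
Qed.

(** * The superharmonic weight *)

(** This is the function [F] in the coordinates where the unperturbed matrix is a rotation; the last
    two arguments of the corrector are the cosine and sine of twice the angle of [(X, Y)]. *)
Definition weight (R : realType) (eta e k1 k2 X Y : R) : R :=
  let N := X ^+ 2 + Y ^+ 2 in
  N `^ (- (1 - eta)) *
  (1 + e ^+ 2 * corrector (1 - eta) (1 - eta - eta / 4) k1 k2
    ((X ^+ 2 - Y ^+ 2) / N) (2 * X * Y / N)).

Lemma weight_scale (R : realType) (eta e k1 k2 n x y : R) : n != 0 ->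
  weight eta e k1 k2 (n * x) (n * y) =
  (n ^+ 2) `^ (- (1 - eta)) * weight eta e k1 k2 x y.
Proof.
move=> n0; rewrite /weight /=.
have -> : (n * x) ^+ 2 + (n * y) ^+ 2 = n ^+ 2 * (x ^+ 2 + y ^+ 2) by ring.
rewrite powRM ?sqr_ge0 ?addr_ge0 ?sqr_ge0 // -mulrA.
have n2 : n ^+ 2 != 0 by rewrite sqrf_eq0.
have -> : (n * x) ^+ 2 - (n * y) ^+ 2 = n ^+ 2 * (x ^+ 2 - y ^+ 2) by ring.
have -> : 2 * (n * x) * (n * y) = n ^+ 2 * (2 * x * y) by ring.
by rewrite !(mulrC (n ^+ 2)) -!mulf_div !divff // !mulr1.
Qed.

Lemma weight_unit (R : realType) (eta e k1 k2 x y : R) :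
  x ^+ 2 + y ^+ 2 = 1 -> weight eta e k1 k2 x y =
  1 + e ^+ 2 * corrector (1 - eta) (1 - eta - eta / 4) k1 k2
    (x ^+ 2 - y ^+ 2) (2 * x * y).
Proof. by move=> xy; rewrite /weight /= xy powR1 mul1r !divr1. Qed.

Lemma polar_unit (R : realType) (X Y : R) : 0 < X ^+ 2 + Y ^+ 2 ->
  exists n x y, [/\ 0 < n, n ^+ 2 = X ^+ 2 + Y ^+ 2, X = n * x, Y = n * y &
    x ^+ 2 + y ^+ 2 = 1].
Proof.
move=> N0; set n := Num.sqrt (X ^+ 2 + Y ^+ 2).
have n0 : 0 < n by rewrite sqrtr_gt0.
have nn0 : n != 0 by rewrite gt_eqF.
have nE : n ^+ 2 = X ^+ 2 + Y ^+ 2 by rewrite sqr_sqrtr // ltW.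
exists n, (X / n), (Y / n).
split; [exact: n0 | exact: nE | by rewrite mulrC divfK | by rewrite mulrC divfK |].
by rewrite !exprMn exprVn -mulrDl -nE divff // sqrf_eq0.
Qed.

(** By homogeneity it suffices to treat unit vectors. There [shear_mean_le], applied to the rotated
    vector, leaves the corrector at that vector minus the oscillating terms, and [corrector_rot]
    identifies this with the corrector at the original vector. *)
Lemma weight_superharmonic (R : realType) (sigma : R) : 0 < sigma <= 1 ->
  exists2 C : R, 0 < C & forall c s e eta : R, c ^+ 2 + s ^+ 2 = 1 ->
    sigma <= `|c| -> sigma <= `|s| -> 0 < e -> C * e <= eta -> eta < 1 / 2 ->
    exists gamma (F : R -> R -> R), [/\ 0 < gamma < 1, forall X Y, 0 <= F X Y,
      forall X Y, 0 < X ^+ 2 + Y ^+ 2 ->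
        1 / 2 * (X ^+ 2 + Y ^+ 2) `^ (- (1 - eta)) <= F X Y <=
        2 * (X ^+ 2 + Y ^+ 2) `^ (- (1 - eta)) &
      forall X Y, 0 < X ^+ 2 + Y ^+ 2 ->
        let X' := c * X + s * Y in let Y' := c * Y - s * X in
        F X' (Y' + e * X') + F X' (Y' - e * X') <= 2 * ((1 - gamma) * F X Y)].
Proof.
(* This [K] bounds both cotangents: their numerators are at most 1 in absolute value, their
   denominators at least [sigma] and [2 * sigma ^+ 2]. *)
move=> /andP[sg0 sg1]; set K := sigma ^- 2.
have K1 : 1 <= K by rewrite /K invf_ge1 ?exprn_gt0 // expr_le1 // ltW.
have K0 : 0 < K by lra.
exists (1000 * K); first by lra.
move=> c s e eta cs sc ss e0 Ceta eta2.
have c0 : c != 0 by rewrite -normr_gt0; apply: lt_le_trans sc.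
have s0 : s != 0 by rewrite -normr_gt0; apply: lt_le_trans ss.
have eta0 : 0 < eta by apply: lt_le_trans Ceta; apply: mulr_gt0; lra.
have eta01 : 0 < eta < 1 / 2 by rewrite eta0 eta2.
have Ke : K * e <= 1 / 2000 by lra.
have e8 : e <= 1 / 8 by nra.
have e08 : 0 < e <= 1 / 8 by rewrite e0 e8.
have eK : e ^+ 2 * K <= 1 / 2.
  have -> : e ^+ 2 * K = e * (K * e) by ring.
  nra.
set k1 := c / s; set k2 := (c ^+ 2 - s ^+ 2) / (2 * c * s).
have [c1 s1 cs1 _] := unit_circle_bounds cs.
have k1K : `|k1| <= K.
  rewrite /k1 normrM normfV ler_pdivrMr ?normr_gt0 //.
  apply: le_trans c1 _; rewrite mulrC ler_pdivlMr ?exprn_gt0 // mul1r.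
  by apply: le_trans ss; rewrite expr2 ger_pMl.
have k2K : `|k2| <= K.
  rewrite /k2 normrM normfV ler_pdivrMr ?normr_gt0 ?mulf_neq0 //.
  apply: le_trans cs1 _; rewrite mulrC ler_pdivlMr ?exprn_gt0 // mul1r.
  rewrite !normrM (ger0_norm (ler0n _ 2)).
  have : sigma * sigma <= `|c| * `|s| by apply: ler_pM => //; exact: ltW.
  rewrite expr2; nra.
have al01 : 0 <= 1 - eta <= 1 by lra.
have be01 : 0 <= 1 - eta - eta / 4 <= 1 by lra.
(* The absolute gain on unit vectors is [eta * e ^+ 2 / 16]. Since the weight is at most 2 there,
   half of this number serves as a relative gain. *)
exists (eta * e ^+ 2 / 32), (weight eta e k1 k2).
have e20 : 0 < e ^+ 2 by rewrite exprn_gt0.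
have g1 : 0 < eta * e ^+ 2 / 32 by rewrite divr_gt0 ?mulr_gt0.
have half x y : x ^+ 2 + y ^+ 2 = 1 -> 1 / 2 <= weight eta e k1 k2 x y <= 3 / 2.
  move=> xy; rewrite weight_unit //.
  set Q := corrector _ _ _ _ _ _.
  have : `|Q| <= K.
    apply: corrector_bound => //.
    have -> : (x ^+ 2 - y ^+ 2) ^+ 2 + (2 * x * y) ^+ 2 =
       (x ^+ 2 + y ^+ 2) ^+ 2 by ring.
    by rewrite xy expr1n.
  rewrite ler_norml => /andP[q1 q2].
  by apply/andP; split; nra.
have bounds X Y : 0 < X ^+ 2 + Y ^+ 2 ->
    1 / 2 * (X ^+ 2 + Y ^+ 2) `^ (- (1 - eta)) <= weight eta e k1 k2 X Y <=
    2 * (X ^+ 2 + Y ^+ 2) `^ (- (1 - eta)).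
  move=> /polar_unit [n [x [y [n0 nE -> -> xy]]]].
  have nn : n != 0 by rewrite gt_eqF.
  rewrite weight_scale //.
  have -> : (n * x) ^+ 2 + (n * y) ^+ 2 = n ^+ 2 * (x ^+ 2 + y ^+ 2) by ring.
  rewrite xy mulr1.
  have p0 : 0 <= (n ^+ 2) `^ (- (1 - eta)) by exact: powR_ge0.
  have /andP[h1 h2] := half _ _ xy.
  by apply/andP; split; nra.
split.
- rewrite g1 /=.
  have : e ^+ 2 <= 1 by nra.
  nra.
- move=> X Y; have [N0|] := ltP 0 (X ^+ 2 + Y ^+ 2).
    have /andP[h _] := bounds _ _ N0; apply: le_trans h.
    by apply: mulr_ge0; [lra | exact: powR_ge0].
  have := sqr_ge0 X; have := sqr_ge0 Y => Y2 X2 N0.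
  have /eqP : X ^+ 2 = 0 by lra.
  have /eqP : Y ^+ 2 = 0 by lra.
  rewrite !sqrf_eq0 => /eqP -> /eqP ->.
  rewrite /weight /corrector /= !(mulr0, mul0r, expr0n, subr0, addr0, mulr1).
  exact: powR_ge0.
- exact: bounds.
move=> X Y /polar_unit [n [x0 [z0 [n0 nE -> -> xz0]]]] /=.
have nn : n != 0 by rewrite gt_eqF.
pose x := c * x0 + s * z0; pose z := c * z0 - s * x0.
have xz : x ^+ 2 + z ^+ 2 = 1.
  have -> : x ^+ 2 + z ^+ 2 = (c ^+ 2 + s ^+ 2) * (x0 ^+ 2 + z0 ^+ 2).
    by rewrite /x /z; ring.
  by rewrite cs xz0 mulr1.
have -> : c * (n * x0) + s * (n * z0) = n * x by rewrite /x; ring.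
have -> : c * (n * z0) - s * (n * x0) = n * z by rewrite /z; ring.
have -> : n * z + e * (n * x) = n * (z + e * x) by ring.
have -> : n * z - e * (n * x) = n * (z + - e * x) by ring.
rewrite !weight_scale //.
have p0 : 0 <= (n ^+ 2) `^ (- (1 - eta)) by exact: powR_ge0.
move: p0; set p := _ `^ _ => p0; set g := _ / 32; set w0 := weight _ _ _ _ x0 _.
have -> : 2 * ((1 - g) * (p * w0)) = p * (2 * ((1 - g) * w0)) by ring.
rewrite -mulrDr; apply: ler_wpM2l => //; rewrite {}/g {}/w0 {p p0}.
have := shear_mean_le eta01 K1 k1K k2K e08 xz eK Ceta; rewrite /=.
rewrite -/k1 -/k2.
set f1 := (X in X + _ <= _); set f2 := (X in _ + X <= _).
have wE t : weight eta e k1 k2 x (z + t * x) =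
  (1 + (2 * t * x * z + t ^+ 2 * x ^+ 2)) `^ (- (1 - eta)) *
  (1 + e ^+ 2 * corrector (1 - eta) (1 - eta - eta / 4) k1 k2
    ((x ^+ 2 - (z + t * x) ^+ 2) / (1 + (2 * t * x * z + t ^+ 2 * x ^+ 2)))
    (2 * x * (z + t * x) / (1 + (2 * t * x * z + t ^+ 2 * x ^+ 2)))).
  rewrite /weight /=.
  have -> // : x ^+ 2 + (z + t * x) ^+ 2 = 1 + (2 * t * x * z + t ^+ 2 * x ^+ 2).
  have xz' : x ^+ 2 = 1 - z ^+ 2 by rewrite -xz; ring.
  by ring: xz'.
have -> : f1 = weight eta e k1 k2 x (z + e * x) by rewrite wE.
have -> : f2 = weight eta e k1 k2 x (z + - e * x) by rewrite wE.
move/le_trans; apply.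
have := corrector_rot (1 - eta) (1 - eta - eta / 4) (x ^+ 2 - z ^+ 2) (2 * x * z) cs c0 s0.
rewrite /= -/k1 -/k2 => <-.
have -> : (c ^+ 2 - s ^+ 2) * (x ^+ 2 - z ^+ 2) - 2 * c * s * (2 * x * z) =
  x0 ^+ 2 - z0 ^+ 2.
  have -> : x0 ^+ 2 - z0 ^+ 2 = (c ^+ 2 + s ^+ 2) ^+ 2 * (x0 ^+ 2 - z0 ^+ 2).
    by rewrite cs expr1n mul1r.
  by rewrite /x /z; ring.
have -> : 2 * c * s * (x ^+ 2 - z ^+ 2) + (c ^+ 2 - s ^+ 2) * (2 * x * z) =
  2 * x0 * z0.
  have -> : 2 * x0 * z0 = (c ^+ 2 + s ^+ 2) ^+ 2 * (2 * x0 * z0).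
    by rewrite cs expr1n mul1r.
  by rewrite /x /z; ring.
have -> : 1 - eta * e ^+ 2 / 16 + e ^+ 2 * corrector (1 - eta) (1 - eta - eta / 4)
   k1 k2 (x0 ^+ 2 - z0 ^+ 2) (2 * x0 * z0) =
  weight eta e k1 k2 x0 z0 - eta * e ^+ 2 / 16.
  by rewrite weight_unit //; ring.
have /andP[_ h2] := half _ _ xz0.
set g := eta * e ^+ 2 / 32 in g1 *.
have -> : eta * e ^+ 2 / 16 = 2 * g by rewrite /g; field.
nra.
Qed.

(** * Lines and cones under the projective action *)

Section projective_action.
Variable R : realType.
Implicit Types (a x y t : R) (A : set R).

(** The set is periodic of period [pi] in the whole of [R], and the equation by a determinant makes
    preimages under the action sets of the same form. *)
Definition line_set x y : set R := [set t | x * sin t - y * cos t == 0].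

(* The lines in the double cone of the nonnegative combinations of the two
   vectors [(x, y)] and [(x', y')]. *)
Definition cone_set x y x' y' : set R :=
  [set t | 0 <= (x * sin t - y * cos t) * (y' * cos t - x' * sin t)].

(** The scalar [r] eliminates the inverse cotangent: later computations with the image angle are
    linear algebra up to [r]. *)
Lemma proj_act_transferP a t : exists2 r, r != 0 &
  r * cos (proj_act (transfer_mx a) t) = a * cos t - sin t /\
  r * sin (proj_act (transfer_mx a) t) = cos t.
Proof.
have := @line_angleP R (transfer_mx a *m line_vec t).
have E0 : (transfer_mx a *m line_vec t) 0 0 = a * cos t - sin t.
  by rewrite !mxE big_ord_recl big_ord1 !mxE /=; ring.
have E1 : (transfer_mx a *m line_vec t) 1 0 = cos t.
  by rewrite !mxE big_ord_recl big_ord1 !mxE /=; ring.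
case.
  apply/eqP => v0; move: E0 E1; rewrite v0 !mxE => E0 E1.
  have := cos2Dsin2 t; rewrite -E1 expr0n add0r => /eqP.
  by move: E0; rewrite -E1 mulr0 add0r => /eqP; rewrite eq_sym oppr_eq0 => /eqP ->;
    rewrite expr0n eq_sym oner_eq0.
move=> _ [r r0 vE]; exists r => //; rewrite -/(proj_act _ _) in vE.
by rewrite -E0 -E1 vE !mxE.
Qed.

(** The vector [(y, a * y - x)] is the image of [(x, y)] under the inverse of [transfer_mx a], and a
    matrix of determinant 1 preserves the wedge product. *)
Lemma preimage_line_set a x y :
  proj_act (transfer_mx a) @^-1` line_set x y = line_set y (a * y - x).
Proof.
apply/seteqP; rewrite /line_set; split=> t /=;
  have [r r0 [rc rs]] := proj_act_transferP a t;
  have -> : y * sin t - (a * y - x) * cos t =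
    r * (x * sin (proj_act (transfer_mx a) t) - y * cos (proj_act (transfer_mx a) t))
    by rewrite mulrBr !(mulrCA r) rc rs; ring.
  by rewrite mulf_eq0 (negbTE r0).
by rewrite mulf_eq0 (negbTE r0).
Qed.

(** As for lines, with two wedge products: the unknown scalar enters squared, so the sign condition
    is preserved. *)
Lemma preimage_cone_set a x y x' y' :
  proj_act (transfer_mx a) @^-1` cone_set x y x' y' =
  cone_set y (a * y - x) y' (a * y' - x').
Proof.
apply/seteqP; rewrite /cone_set; split=> t /=;
  have [r r0 [rc rs]] := proj_act_transferP a t;
  set u := cos _ in rc *; set v := sin _ in rs *;
  have r2 : 0 < r ^+ 2 by rewrite exprn_even_gt0.
  have -> : (y * sin t - (a * y - x) * cos t) * ((a * y' - x') * cos t - y' * sin t)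
    = r ^+ 2 * ((x * v - y * u) * (y' * u - x' * v)).
    have -> : sin t = a * cos t - r * u by rewrite rc; ring.
    by rewrite -rs; ring.
  by move=> h; rewrite mulr_ge0 // ltW.
have -> : (y * sin t - (a * y - x) * cos t) * ((a * y' - x') * cos t - y' * sin t)
    = r ^+ 2 * ((x * v - y * u) * (y' * u - x' * v)).
  have -> : sin t = a * cos t - r * u by rewrite rc; ring.
  by rewrite -rs; ring.
by rewrite pmulr_rge0.
Qed.

Lemma measurable_wedge x y :
  measurable_fun setT (fun t : measurableTypeR R => x * sin t - y * cos t).
Proof.
apply: measurable_funB; apply: measurable_funM => //;
  apply: continuous_measurable_fun; [exact: continuous_sin|exact: continuous_cos].
Qed.

Lemma measurable_line_set x y :
  measurable (line_set x y : set (measurableTypeR R)).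
Proof.
rewrite (_ : line_set x y =
    setT `&` (fun t => x * sin t - y * cos t) @^-1` [set 0]).
  by apply: measurable_wedge => //; exact: measurable_set1.
by rewrite setTI; apply/seteqP; split=> t /= /eqP.
Qed.

Lemma measurable_cone_set x y x' y' :
  measurable (cone_set x y x' y' : set (measurableTypeR R)).
Proof.
have mf : measurable_fun setT (fun t : measurableTypeR R =>
    (x * sin t - y * cos t) * (- x' * sin t - - y' * cos t)).
  by apply: measurable_funM; exact: measurable_wedge.
rewrite (_ : cone_set x y x' y' = setT `&` (fun t =>
    (x * sin t - y * cos t) * (- x' * sin t - - y' * cos t)) @^-1` `[0, +oo[%classic).
  by apply: mf => //; exact: measurable_itv.
rewrite setTI; apply/seteqP; split=> t /=; rewrite /cone_set /= in_itv /= andbT;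
  by rewrite (_ : - x' * sin t - - y' * cos t = y' * cos t - x' * sin t) //; ring.
Qed.

End projective_action.

(** * Stationarity for real-valued masses *)

Section furstenberg_mass.
Variables (R : realType) (E lambda : R) (nu : probability (measurableTypeR R) R).

Definition mass (A : set R) : R := fine (nu A).

Lemma massE (A : set R) : measurable (A : set (measurableTypeR R)) ->
  nu A = (mass A)%:E.
Proof. by move=> mA; rewrite /mass fineK // fin_num_measure. Qed.

Lemma mass_ge0 (A : set R) : 0 <= mass A.
Proof. by rewrite fine_ge0. Qed.

Lemma mass_le1 (A : set R) : measurable (A : set (measurableTypeR R)) ->
  mass A <= 1.
Proof. by move=> mA; rewrite -lee_fin -massE // probability_le1. Qed.

Lemma le_mass (A B : set R) : measurable (A : set (measurableTypeR R)) ->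
  measurable (B : set (measurableTypeR R)) -> A `<=` B -> mass A <= mass B.
Proof.
by move=> mA mB AB; rewrite -lee_fin -!massE // le_measure //; exact: mem_set.
Qed.

Hypothesis nuF : furstenberg_measure E lambda nu.

Lemma mass_mean (A : set R) : measurable (A : set (measurableTypeR R)) ->
  2 * mass A = mass (proj_act (transfer_mx (E - lambda)) @^-1` A) +
             mass (proj_act (transfer_mx (E + lambda)) @^-1` A).
Proof.
move=> mA; have mp a : measurable
    (proj_act (transfer_mx a) @^-1` A : set (measurableTypeR R)).
  rewrite -[X in measurable X]setTI.
  exact: (measurable_proj_act (transfer_mx a)).
have [_ /(_ _ mA)] := nuF.
rewrite /anderson_bernoulli_law !big_cons big_nil /= adde0 /pushforward.
rewrite !massE // -!EFinM -EFinD => -[->]; by field.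
Qed.

Lemma mass_line_mean (x y : R) :
  2 * mass (line_set x y) = mass (line_set y ((E - lambda) * y - x)) +
                            mass (line_set y ((E + lambda) * y - x)).
Proof.
by rewrite mass_mean ?preimage_line_set //; exact: measurable_line_set.
Qed.

Lemma mass_cone_mean (x y x' y' : R) :
  2 * mass (cone_set x y x' y') =
  mass (cone_set y ((E - lambda) * y - x) y' ((E - lambda) * y' - x')) +
  mass (cone_set y ((E + lambda) * y - x) y' ((E + lambda) * y' - x')).
Proof.
by rewrite mass_mean ?preimage_cone_set //; exact: measurable_cone_set.
Qed.

End furstenberg_mass.

(** * Absence of atoms *)

Lemma seq_has_argmax (R : realType) (T : eqType) (f : T -> R) (k0 : T) (s : seq T) :
  exists2 k1, k1 \in k0 :: s & forall k, k \in k0 :: s -> f k <= f k1.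
Proof.
elim: s k0 => [|h s IH] k0.
  by exists k0; rewrite ?mem_seq1 // => k; rewrite mem_seq1 => /eqP ->.
have [k1 k1s k1P] := IH h.
have [h01|h10] := leP (f k0) (f k1).
  exists k1; first by rewrite inE k1s orbT.
  by move=> k; rewrite inE => /predU1P[->//|/k1P].
exists k0; first by rewrite mem_head.
move=> k; rewrite inE => /predU1P[->//|/k1P /le_trans]; apply; exact: ltW.
Qed.

Lemma line_set_scale (R : realType) (r x y : R) : r != 0 ->
  line_set (r * x) (r * y) = line_set x y.
Proof.
move=> r0; apply/seteqP; rewrite /line_set; split=> t /=;
  by rewrite -!mulrA -mulrBr mulf_eq0 (negbTE r0).
Qed.

Section no_atom.
Variables (R : realType) (E lambda : R) (nu : probability (measurableTypeR R) R).
Hypothesis lambda0 : 0 < lambda.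
Hypothesis nuF : furstenberg_measure E lambda nu.

Let m (k : R) := mass nu (line_set 1 k).

(* With [0^-1 = 0] the formula also covers the line [k = 0], which is mapped to
   the vertical line and then, one step later, to [E - lambda] and [E + lambda]. *)
Lemma slope_mass_mean (k : R) :
  2 * m k = m (E - lambda - k^-1) + m (E + lambda - k^-1).
Proof.
have ms a : k != 0 -> line_set k (a * k - 1) = line_set 1 (a - k^-1).
  move=> k0; rewrite -[RHS](line_set_scale _ _ k0) mulr1; congr line_set.
  by rewrite mulrBr mulfV // mulrC.
have [->|k0] := eqVneq k 0; last by rewrite /m (mass_line_mean nuF) !ms.
rewrite invr0 !subr0 /m (mass_line_mean nuF) !mulr0 sub0r.
have -> : line_set 0 (-1) = line_set 0 1 :> set R.
  by rewrite -[RHS](@line_set_scale _ (-1)) ?oppr_eq0 ?oner_eq0 // mulr0 mulr1.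
by rewrite -mulr2n -mulr_natl (mass_line_mean nuF) !mulr1 !subr0.
Qed.

(** Distinct slopes give disjoint sets, and more than [p^-1] of them with mass at least [p] would
    exceed the total mass 1. *)
Lemma finite_heavy_slopes (p : R) : 0 < p -> finite_set [set k | p <= m k].
Proof.
move=> p0; apply: contrapT => inf.
have [B Bp sB] := infinite_set_fset (Num.truncn p^-1).+1 inf.
have mL k : measurable (line_set 1 k : set (measurableTypeR R)).
  exact: measurable_line_set.
have tB : trivIset [set` B] (line_set 1).
  move=> i j _ _ [t [/eqP it /eqP jt]].
  have sc := cos2Dsin2 t; apply/eqP/negPn/negP => ij.
  have c0 : cos t = 0.
    have : (i - j) * cos t = 0 by move: it jt; lra.
    by move=> /eqP; rewrite mulf_eq0 subr_eq0 (negbTE ij) => /eqP.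
  have s0 : sin t = 0 by move: it; rewrite c0; lra.
  by move/eqP: sc; rewrite c0 s0 !expr0n addr0 eq_sym oner_eq0.
have := @measure_fbigsetU _ R _ nu _ B (line_set 1) (fun k _ => mL k) tB.
set U := \big[_/_]_(_ <- _) _ => UE.
have mU : measurable (U : set (measurableTypeR R)).
  by apply: bigsetU_measurable => k _; exact: mL.
have : (nu U <= 1)%E by exact: probability_le1.
rewrite UE (eq_bigr (fun k => (m k)%:E)); last by move=> k _; exact: massE.
rewrite sumEFin lee_fin; apply/negP; rewrite -ltNge.
apply: (@lt_le_trans _ _ (\sum_(k <- finmap.enum_fset B) p)).
  rewrite big_const_seq count_predT iter_addr_0 -mulr_natr -ltr_pdivrMl // mulr1.
  apply: lt_le_trans (truncnS_gt _) _; by rewrite ler_nat.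
rewrite big_seq [leRHS]big_seq; apply: ler_sum => k kB; exact: Bp.
Qed.

(** If some slope had positive mass, the slopes of maximal mass would form a finite nonempty set
    [s]. By the mean property both maps [j |-> a - j^-1], with [a = E - lambda] and
    [a = E + lambda], send [s] into itself, and being injective they permute it. Both families of
    images thus have the same sum as [s], while these sums differ by [2 * lambda] times the size of
    [s]. *)
Lemma mass_slope0 (k : R) : m k = 0.
Proof.
apply/eqP/negPn/negP => mk0.
have {mk0}mk0 : 0 < m k by rewrite lt_neqAle eq_sym mk0 mass_ge0.
have /finite_seqP [s0 /seteqP s0E] := finite_heavy_slopes mk0.
have [k1 k1s k1P] := seq_has_argmax m k s0.
have {k1P}k1P j : m j <= m k1.
  have [kj|jk] := leP (m k) (m j).
    by apply: k1P; rewrite inE; apply/orP; right; exact: s0E.1.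
  by apply: le_trans (ltW jk) (k1P _ _); rewrite mem_head.
have mk1 : 0 < m k1 by apply: lt_le_trans mk0 (k1P k).
have /finite_seqP [s1 /seteqP s1E] := finite_heavy_slopes mk1.
pose s := undup s1.
have sP j : (j \in s) = (m k1 <= m j).
  by rewrite mem_undup; apply/idP/idP => h; [exact: s1E.2 | exact: s1E.1].
have stab a : (a = E - lambda \/ a = E + lambda) ->
    \sum_(j <- s) j = \sum_(j <- s) (a - j^-1).
  move=> aE; have inj : injective (fun j : R => a - j^-1).
    by move=> i j /(congr1 (fun x => a - x)); rewrite !subKr => /invr_inj.
  have us : uniq [seq a - j^-1 | j <- s] by rewrite map_inj_uniq ?undup_uniq.
  have sub : {subset [seq a - j^-1 | j <- s] <= s}.
    move=> _ /mapP [j + ->]; rewrite !sP => mj.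
    have := slope_mass_mean j.
    have := k1P (E - lambda - j^-1); have := k1P (E + lambda - j^-1).
    by case: aE => ->; lra.
  have [_ eqs] := uniq_min_size us sub (eq_leq (esym (size_map _ _))).
  rewrite -(big_map (fun j : R => a - j^-1) xpredT id) /=.
  by apply: perm_big; rewrite perm_sym uniq_perm ?undup_uniq.
have := stab (E - lambda) (or_introl erefl).
rewrite (stab (E + lambda) (or_intror erefl)) => /eqP.
rewrite -subr_eq0 -sumrB (eq_bigr (fun=> 2 * lambda)); last by move=> j _; ring.
rewrite big_const_seq count_predT iter_addr_0 mulrn_eq0 size_eq0 mulf_eq0.
rewrite (gt_eqF lambda0) pnatr_eq0 !orbF => /eqP s0'.
by have := sP k1; rewrite s0' lexx.
Qed.

Lemma mass_line0 (x y : R) : (x, y) != (0, 0) -> mass nu (line_set x y) = 0.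
Proof.
have [->|x0 _] := eqVneq x 0; last first.
  have -> : y = x * (y / x) by rewrite mulrC divfK.
  by rewrite -{1}(mulr1 x) line_set_scale //; exact: mass_slope0.
rewrite xpair_eqE eqxx /= => y0.
have -> : line_set 0 y = line_set 0 1.
  by rewrite -{1}(mulr1 y) -{1}(mulr0 y) line_set_scale.
have := mass_line_mean nuF 0 1; rewrite !mulr1 !subr0.
rewrite -/(m _) -/(m (E + lambda)) !mass_slope0; lra.
Qed.

End no_atom.

(** * Uniform smallness of the mass of small balls *)

(** The quantity [|sin (t - s)|] is a distance between lines; its invariance under adding [pi] to an
    angle avoids any special case at the ends of the fundamental domain. *)
Definition angle_ball (R : realType) (s d : R) : set R :=
  [set t | `|sin (t - s)| <= d].

Lemma measurable_angle_ball (R : realType) (s d : R) :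
  measurable (angle_ball s d : set (measurableTypeR R)).
Proof.
have mf := @measurable_wedge R (cos s) (sin s).
rewrite (_ : angle_ball s d = setT `&`
    (fun t => cos s * sin t - sin s * cos t) @^-1` `[- d, d]%classic).
  by apply: mf => //; exact: measurable_itv.
rewrite setTI; apply/seteqP; split=> t; rewrite /angle_ball /= in_itv /= -ler_norml;
  by rewrite sinB mulrC (mulrC (sin s)).
Qed.

Lemma normr_sin_le (R : realType) (x : R) : `|sin x| <= `|x|.
Proof.
wlog x0 : x / 0 <= x.
  move=> h; have [/h //|/ltW x0] := leP 0 x.
  by rewrite -(normrN x) -(normrN (sin x)) -sinN; apply: h; rewrite oppr_ge0.
have sc : {within `[0, x], continuous (@sin R)}.
  by apply: continuous_subspaceT => y; exact: continuous_sin.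
have [c _ cE] := MVT_segment x0 (fun y _ => is_derive_sin y) sc.
by move: cE; rewrite sin0 !subr0 => ->; rewrite normrM ler_piMl ?cos_max.
Qed.

Lemma sinB_triangle (R : realType) (t x s : R) :
  `|sin (t - s)| <= `|sin (t - x)| + `|sin (x - s)|.
Proof.
have -> : t - s = (t - x) + (x - s) by ring.
rewrite sinD; apply: le_trans (ler_normD _ _) _.
rewrite !normrM; have := cos_max (t - x); have := cos_max (x - s).
have := normr_ge0 (sin (t - x)); have := normr_ge0 (sin (x - s)); nra.
Qed.

(** At a fixed centre the balls decrease to a null line. Uniformity comes from compactness of
    [[0, pi]], because a ball of radius below [d / 2] around a centre close to [s] lies in the ball
    of radius [d] around [s]. *)
Lemma mass_angle_ball_small (R : realType)
    (nu : probability (measurableTypeR R) R) (e : R) : 0 < e ->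
  (forall s, mass nu (line_set (cos s) (sin s)) = 0) ->
  exists2 d, 0 < d & forall s, 0 <= s <= pi -> mass nu (angle_ball s d) <= e.
Proof.
move=> e0 nu0.
have pointwise s : exists2 d, 0 < d & mass nu (angle_ball s d) < e.
  pose B n := angle_ball s (n.+1%:R^-1 : R).
  have mB n : measurable (B n : set (measurableTypeR R)).
    exact: measurable_angle_ball.
  have BE : \bigcap_n B n = line_set (cos s) (sin s).
    apply/seteqP; split=> t; rewrite /line_set /=.
      move=> h; have -> : cos s * sin t - sin s * cos t = sin (t - s).
        by rewrite sinB; ring.
      rewrite -normr_le0; apply/ler_addgt0Pr => x x0; rewrite add0r.
      apply: le_trans (h (Num.truncn x^-1) I) _.
      by rewrite invf_ple ?posrE // ltW // truncnS_gt.
    move=> /eqP h n _; rewrite /B /angle_ball /= sinB.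
    have -> : sin t * cos s - cos t * sin s = 0 by rewrite -h; ring.
    by rewrite normr0 invr_ge0.
  have Bcvg : (nu \o B) n @[n --> \oo] --> nu (\bigcap_n B n).
    apply: nonincreasing_cvg_mu => //.
    - by apply: le_lt_trans (probability_le1 _ (mB 0%N)) _; rewrite ltry.
    - by apply: bigcapT_measurable.
    - move=> i j ij; apply/subsetPset => t; rewrite /B /angle_ball /= => /le_trans.
      by apply; rewrite lef_pV2 ?posrE // ler_nat.
  have lim0 : nu (\bigcap_n B n) = 0%E.
    by rewrite BE massE ?nu0 //; exact: measurable_line_set.
  rewrite lim0 in Bcvg.
  have : \forall n \near \oo, (nu (B n) < e%:E)%E.
    have e0' : (0 < e%:E)%E by rewrite lte_fin.
    exact: (Bcvg [set u | (u < e%:E)%E] (open_ereal_lt' e0')).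
  move=> /filter_ex [n]; rewrite massE // lte_fin => hn.
  by exists n.+1%:R^-1; rewrite // invr_gt0.
have cpt : compact `[0, pi : R] := @segment_compact R 0 pi.
have /compact_near_coveringP cov := cpt.
have near_small : forall s : R, `[0, pi]%classic s ->
    \forall s' \near s & d \near (0 : R)^'+, mass nu (angle_ball s' d) <= e.
  move=> s _; have [d d0 sd] := pointwise s.
  have d20 : 0 < d / 2 by rewrite divr_gt0.
  exists ([set s' | `|sin (s' - s)| < d / 2], [set d' : R | d' < d / 2]).
    split => /=; last exact: nbhs_right_lt.
    have near_s := @cvgr_distC_lt _ _ _ (nbhs s) (nbhs_filter s) id s (@cvg_id _ _) _ d20.
    rewrite /=; apply: filterS near_s => s' h.
    exact: le_lt_trans (normr_sin_le _) h.
  move=> [s' d'] /= [h1 h2]; apply: le_trans (ltW sd).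
  apply: le_mass; try exact: measurable_angle_ball.
  move=> t; rewrite /angle_ball /= => h3.
  by have := sinB_triangle t s' s; lra.
have near_all := cov _ _ _ (at_right_proper_filter 0) near_small.
have [d [hd d0]] := filter_ex (filterI near_all (nbhs_right_gt (0 : R))).
by exists d => // s s0; apply: hd => /=; rewrite in_itv.
Qed.

(** * The invariant inner product and acute pairs of vectors *)

(* The inner product invariant under the transfer matrix of energy [E]. *)
Definition energy_dot (R : realType) (E x y x' y' : R) : R :=
  (1 - E ^+ 2 / 4) * (x * x') + (y - E / 2 * x) * (y' - E / 2 * x').

Local Notation energy_norm E x y := (energy_dot E x y x y).

Lemma energy_dot_lagrange (R : realType) (E x y x' y' : R) :
  energy_norm E x y * energy_norm E x' y' =
  energy_dot E x y x' y' ^+ 2 + (1 - E ^+ 2 / 4) * (x * y' - y * x') ^+ 2.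
Proof. by rewrite /energy_dot; field. Qed.

Lemma energy_coef (R : realType) (E : R) : `|E| < 2 -> 0 < 1 - E ^+ 2 / 4 <= 1.
Proof.
rewrite ltr_norml => /andP[E1 E2].
by have := sqr_ge0 E; move=> ?; apply/andP; split; nra.
Qed.

Lemma energy_norm_ge0 (R : realType) (E x y : R) : `|E| < 2 ->
  0 <= energy_norm E x y.
Proof.
move=> /energy_coef /andP[k0 _].
by rewrite /energy_dot -!expr2 addr_ge0 ?sqr_ge0 // mulr_ge0 ?sqr_ge0 // ltW.
Qed.

Lemma energy_norm_gt0 (R : realType) (E x y x' y' : R) : `|E| < 2 ->
  0 < energy_dot E x y x' y' ->
  0 < energy_norm E x y /\ 0 < energy_norm E x' y'.
Proof.
move=> E2 d0; have /andP[k0 _] := energy_coef E2.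
have : 0 < energy_norm E x y * energy_norm E x' y'.
  rewrite energy_dot_lagrange ltr_pwDl ?exprn_gt0 //.
  by rewrite mulr_ge0 ?sqr_ge0 // ltW.
have n0 := energy_norm_ge0 x y E2; have n0' := energy_norm_ge0 x' y' E2.
rewrite !lt_neqAle n0 n0' !andbT.
move=> /andP[h _]; split; apply: contraNneq h => <-; rewrite ?mul0r ?mulr0 //.
Qed.

Lemma energy_norm_circle (R : realType) (E t : R) : `|E| < 2 ->
  energy_norm E (cos t) (sin t) <= 2.
Proof.
rewrite ltr_norml => /andP[E1 E2].
have -> : energy_norm E (cos t) (sin t) =
  cos t ^+ 2 + sin t ^+ 2 - E * (cos t * sin t) by rewrite /energy_dot; field.
rewrite cos2Dsin2.
have := cos2Dsin2 t; have := sqr_ge0 (cos t - sin t).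
have := sqr_ge0 (cos t + sin t); nra.
Qed.

(** The second hypothesis says that the angle is at most 60 degrees. By Cauchy-Schwarz
    [a * b' + a' * b] and [a * a'] are then at most [2 * d] in absolute value, so the shear lowers
    the inner product by at most [d / 2 + d / 8]. *)
Lemma energy_dot_shear (R : realType) (a b a' b' e : R) :
  0 < a * a' + b * b' ->
  (a ^+ 2 + b ^+ 2) * (a' ^+ 2 + b' ^+ 2) <= 4 * (a * a' + b * b') ^+ 2 ->
  `|e| <= 1 / 4 -> 0 < a * a' + (b + e * a) * (b' + e * a').
Proof.
set d := a * a' + b * b' => d0 h; rewrite ler_norml => /andP[e1 e2].
have n (u : R) : u ^+ 2 <= (2 * d) ^+ 2 -> - (2 * d) <= u <= 2 * d.
  by rewrite -ler_norml -real_normK ?num_real // ler_pXn2r // nnegrE; lra.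
have h2 : (a ^+ 2 + b ^+ 2) * (a' ^+ 2 + b' ^+ 2) <= (2 * d) ^+ 2.
  by apply: le_trans h _; rewrite exprMn; lra.
have /andP[c1 c2] : - (2 * d) <= a * b' + a' * b <= 2 * d.
  apply: n; apply: le_trans h2; rewrite -subr_ge0.
  have -> : (a ^+ 2 + b ^+ 2) * (a' ^+ 2 + b' ^+ 2) - (a * b' + a' * b) ^+ 2 =
    (a * a' - b * b') ^+ 2 by ring.
  exact: sqr_ge0.
have /andP[c3 c4] : - (2 * d) <= a * a' <= 2 * d.
  apply: n; apply: le_trans h2; rewrite -subr_ge0.
  have -> : (a ^+ 2 + b ^+ 2) * (a' ^+ 2 + b' ^+ 2) - (a * a') ^+ 2 =
    (a * b') ^+ 2 + (b * a') ^+ 2 + (b * b') ^+ 2 by ring.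
  by rewrite !addr_ge0 ?sqr_ge0.
have -> : a * a' + (b + e * a) * (b' + e * a') =
  d + e * (a * b' + a' * b) + e ^+ 2 * (a * a') by rewrite /d; ring.
have e20 := sqr_ge0 e.
have e216 : e ^+ 2 <= 1 / 16 by nra.
have l1 : - (d / 2) <= e * (a * b' + a' * b) by nra.
have l2 : - (d / 8) <= e ^+ 2 * (a * a') by nra.
lra.
Qed.

(** In the coordinates [(S * x, y - E / 2 * x)] the inverse transfer matrix at energy [E + tau] is a
    rotation followed by the shear of parameter [tau / S]. This keeps the images of narrow pairs
    among the acute pairs. *)
Lemma energy_dot_step (R : realType) (E tau x y x' y' : R) : `|E| < 2 ->
  0 < energy_dot E x y x' y' ->
  energy_norm E x y * energy_norm E x' y' <= 4 * energy_dot E x y x' y' ^+ 2 ->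
  16 * tau ^+ 2 <= 1 - E ^+ 2 / 4 ->
  0 < energy_dot E y ((E + tau) * y - x) y' ((E + tau) * y' - x').
Proof.
move=> /energy_coef /andP[k0 _] d0 nd taule.
set S := Num.sqrt (1 - E ^+ 2 / 4).
have S0 : 0 < S by rewrite sqrtr_gt0.
have SE : 1 - E ^+ 2 / 4 = S ^+ 2 by rewrite sqr_sqrtr // ltW.
have dE (p q p' q' : R) : energy_dot E p q p' q' =
    (S * p) * (S * p') + (q - E / 2 * p) * (q' - E / 2 * p').
  by rewrite /energy_dot SE; ring.
have e4 : `|tau / S| <= 1 / 4.
  rewrite normrM normfV (gtr0_norm S0) ler_pdivrMr //.
  rewrite -(ler_pXn2r (n := 2)) ?nnegrE ?mulr_ge0 ?(ltW S0) //.
  rewrite real_normK ?num_real // exprMn -SE; lra.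
have -> : energy_dot E y ((E + tau) * y - x) y' ((E + tau) * y' - x') =
  (S * y) * (S * y') + ((E / 2 * y - x) + tau / S * (S * y)) *
                       ((E / 2 * y' - x') + tau / S * (S * y')).
  by rewrite dE; field; rewrite gt_eqF.
have inv (p q p' q' : R) : energy_dot E p q p' q' =
    (S * q) * (S * q') + (E / 2 * q - p) * (E / 2 * q' - p').
  have -> : S * q * (S * q') = S ^+ 2 * (q * q') by ring.
  by rewrite -SE /energy_dot; field.
apply: energy_dot_shear => //; first by rewrite -inv.
by move: nd; rewrite !inv !expr2.
Qed.

(** By Cramer's rule the unit vector of angle [t], multiplied by the determinant of the pair, is [b]
    times the first vector plus [a] times the second. In its squared norm the cross term is
    nonnegative, so the term in [a ^+ 2] alone is bounded. Hence a cone of small [pair_ratio] lies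
    in a small ball. *)
Lemma cone_set_wedge (R : realType) (E x y x' y' t : R) : `|E| < 2 ->
  0 < energy_dot E x y x' y' -> cone_set x y x' y' t ->
  (x * sin t - y * cos t) ^+ 2 * energy_norm E x' y' <=
  2 * (x * y' - y * x') ^+ 2.
Proof.
move=> E2 d0; rewrite /cone_set /=.
set a := x * sin t - y * cos t; set b := y' * cos t - x' * sin t => ab.
have n0 := energy_norm_ge0 x y E2.
have h : (x * y' - y * x') ^+ 2 * energy_norm E (cos t) (sin t) =
  b ^+ 2 * energy_norm E x y + 2 * (a * b) * energy_dot E x y x' y'
  + a ^+ 2 * energy_norm E x' y' by rewrite /energy_dot /a /b; field.
have h2 := energy_norm_circle t E2.
have w2 := sqr_ge0 (x * y' - y * x').
have h3 : 0 <= b ^+ 2 * energy_norm E x y by rewrite mulr_ge0 // sqr_ge0.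
have h4 : 0 <= 2 * (a * b) * energy_dot E x y x' y'.
  by rewrite mulr_ge0 ?(ltW d0) // mulr_ge0.
have h5 : (x * y' - y * x') ^+ 2 * energy_norm E (cos t) (sin t) <=
  (x * y' - y * x') ^+ 2 * 2 by apply: ler_wpM2l.
lra.
Qed.

Lemma polar_coord (R : realType) (x y : R) : (x, y) != (0, 0) ->
  exists r s, [/\ r != 0, 0 <= s <= pi, x = r * cos s & y = r * sin s].
Proof.
move=> xy0; pose v : 'cV[R]_2 := \col_i (if i == 0 then x else y).
have v0 : v != 0.
  apply: contra_neq xy0 => v0.
  by move: (congr1 (fun u : 'cV[R]_2 => (u 0 0, u 1 0)) v0); rewrite !mxE.
have [c [r r0 vE]] := line_angleP v0.
exists r, (line_angle v); split => //.
- by move: c; rewrite /circle /= in_itv /= => /andP[-> /ltW ->].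
- by move: (congr1 (fun u : 'cV[R]_2 => u 0 0) vE); rewrite !mxE.
- by move: (congr1 (fun u : 'cV[R]_2 => u 1 0) vE); rewrite !mxE.
Qed.

Lemma sqrt_cauchy (R : realType) (a b c d : R) :
  0 <= a -> 0 <= b -> 0 <= c -> 0 <= d ->
  Num.sqrt (a * b) + Num.sqrt (c * d) <= Num.sqrt ((a + c) * (b + d)).
Proof.
move=> a0 b0 c0 d0.
rewrite -(ler_pXn2r (n := 2)) ?nnegrE ?addr_ge0 ?sqrtr_ge0 //.
rewrite sqr_sqrtr ?mulr_ge0 ?addr_ge0 // !sqrtrM //.
have := sqr_ge0 (Num.sqrt a * Num.sqrt d - Num.sqrt c * Num.sqrt b).
move: (sqr_sqrtr a0) (sqr_sqrtr b0) (sqr_sqrtr c0) (sqr_sqrtr d0).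
set p := Num.sqrt a; set q := Num.sqrt b; set r := Num.sqrt c; set s := Num.sqrt d.
move=> <- <- <- <- h; rewrite -subr_ge0.
have -> : (p ^+ 2 + r ^+ 2) * (q ^+ 2 + s ^+ 2) - (p * q + r * s) ^+ 2 =
  (p * s - r * q) ^+ 2 by ring.
exact: h.
Qed.

(** * The energy of a pair of vectors *)

Section energy_of_pairs.
Variables (R : realType) (E lambda al gamma : R) (f : R -> R -> R).

Definition pair_energy (x y x' y' : R) : R :=
  Num.sqrt (((x * y' - y * x') ^+ 2) `^ al * (f x y * f x' y')).

(** By [energy_dot_lagrange], for nonzero vectors and [|E| < 2], this is the squared sine of the
    angle for [energy_dot], divided by [1 - E ^+ 2 / 4]. *)
Definition pair_ratio (x y x' y' : R) : R :=
  (x * y' - y * x') ^+ 2 / (energy_norm E x y * energy_norm E x' y').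

Hypothesis al0 : 0 < al.
Hypothesis f_bounds : forall x y, 0 < energy_norm E x y ->
  1 / 2 * energy_norm E x y `^ (- al) <= f x y <=
  2 * energy_norm E x y `^ (- al).
Hypothesis f_mean : forall x y, 0 < energy_norm E x y ->
  f y ((E - lambda) * y - x) + f y ((E + lambda) * y - x) <=
  2 * ((1 - gamma) * f x y).
Hypothesis gamma01 : 0 < gamma < 1.

Lemma pair_energy_bounds (x y x' y' : R) :
  0 < energy_norm E x y -> 0 < energy_norm E x' y' ->
  1 / 2 * Num.sqrt (pair_ratio x y x' y' `^ al) <= pair_energy x y x' y' <=
  2 * Num.sqrt (pair_ratio x y x' y' `^ al).
Proof.
move=> n0 n0'.
have /andP[f1 f2] := f_bounds n0; have /andP[f1' f2'] := f_bounds n0'.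
set N := energy_norm E x y in n0 f1 f2.
set N' := energy_norm E x' y' in n0' f1' f2'.
set w := (x * y' - y * x') ^+ 2.
have w0 : 0 <= w by exact: sqr_ge0.
have p0 : 0 < N `^ (- al) by exact: powR_gt0.
have p0' : 0 < N' `^ (- al) by exact: powR_gt0.
have rE : pair_ratio x y x' y' `^ al = w `^ al * (N `^ (- al) * N' `^ (- al)).
  rewrite /pair_ratio -/w -/N -/N' powRM // ?invr_ge0 ?mulr_ge0 ?ltW //.
  by rewrite -powR_inv1 ?mulr_ge0 ?ltW // -powRrM mulN1r powRM // ltW.
have q0 := powR_ge0 w al.
have half : 1 / 2 = Num.sqrt ((1 / 2) ^+ 2) :> R by rewrite sqrtr_sqr ger0_norm.
have two : 2 = Num.sqrt (2 ^+ 2) :> R by rewrite sqrtr_sqr ger0_norm.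
have F0 : 0 <= f x y by apply: le_trans f1; rewrite mulr_ge0 // ltW.
have F0' : 0 <= f x' y' by apply: le_trans f1'; rewrite mulr_ge0 // ltW.
rewrite rE /pair_energy -/w.
have le1 : 1 / 2 * N `^ (- al) * (1 / 2 * N' `^ (- al)) <= f x y * f x' y'.
  by apply: ler_pM => //; rewrite mulr_ge0 // ltW.
have le2 : f x y * f x' y' <= 2 * N `^ (- al) * (2 * N' `^ (- al)).
  exact: ler_pM.
apply/andP; split.
  rewrite half -sqrtrM ?sqr_ge0 // ler_wsqrtr //.
  have := ler_wpM2l q0 le1.
  by apply: le_trans; rewrite le_eqVlt; apply/orP; left; apply/eqP; ring.
rewrite two -sqrtrM ?sqr_ge0 // ler_wsqrtr //.
have := ler_wpM2l q0 le2.
by move/le_trans; apply; rewrite le_eqVlt; apply/orP; left; apply/eqP; ring.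
Qed.

(* The determinant [x * y' - y * x'] is invariant, so that Cauchy-Schwarz turns
   the inequality for [f] into one for pairs, without any loss. *)
Lemma pair_energy_mean (x y x' y' : R) :
  (forall a b, 0 <= f a b) ->
  0 < energy_norm E x y -> 0 < energy_norm E x' y' ->
  pair_energy y ((E - lambda) * y - x) y' ((E - lambda) * y' - x') +
  pair_energy y ((E + lambda) * y - x) y' ((E + lambda) * y' - x') <=
  2 * ((1 - gamma) * pair_energy x y x' y').
Proof.
move=> fp n0 n0'; have h := f_mean n0; have h' := f_mean n0'.
rewrite /pair_energy.
have wE t : (y * (t * y' - x') - (t * y - x) * y') = x * y' - y * x' by ring.
rewrite !wE; set w := _ `^ al.
have w0 : 0 <= w by exact: powR_ge0.
rewrite !(sqrtrM _ w0) -mulrDr.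
have -> : 2 * ((1 - gamma) * (Num.sqrt w * Num.sqrt (f x y * f x' y'))) =
  Num.sqrt w * (2 * (1 - gamma) * Num.sqrt (f x y * f x' y')) by ring.
apply: ler_wpM2l; first exact: sqrtr_ge0.
apply: le_trans (sqrt_cauchy _ _ _ _) _ => //.
have /andP[g0 g1] := gamma01.
have c0 : 0 <= 2 * (1 - gamma) by lra.
rewrite -{1}(ger0_norm c0) -sqrtr_sqr -sqrtrM ?sqr_ge0 //.
apply: ler_wsqrtr; rewrite expr2 mulrACA.
by apply: ler_pM; rewrite ?addr_ge0 // -mulrA.
Qed.

End energy_of_pairs.

(** * The maximum principle for the mass of cones *)

Lemma cone_mass_le (R : realType) (E lambda al gamma : R) (f : R -> R -> R)
    (nu : probability (measurableTypeR R) R) :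
  `|E| < 2 -> 0 < lambda -> 16 * lambda ^+ 2 <= 1 - E ^+ 2 / 4 -> 0 < al ->
  0 < gamma < 1 -> (forall x y, 0 <= f x y) ->
  (forall x y, 0 < energy_norm E x y ->
    1 / 2 * energy_norm E x y `^ (- al) <= f x y <=
    2 * energy_norm E x y `^ (- al)) ->
  (forall x y, 0 < energy_norm E x y ->
    f y ((E - lambda) * y - x) + f y ((E + lambda) * y - x) <=
    2 * ((1 - gamma) * f x y)) ->
  furstenberg_measure E lambda nu ->
  exists2 K : R, 0 < K & forall x y x' y', 0 < energy_dot E x y x' y' ->
    mass nu (cone_set x y x' y') <= K * pair_energy al f x y x' y'.
Proof.
move=> E2 l0 l16 al0 g01 f0 fb fm nuF.
have /andP[k0 k1] := energy_coef E2.
have /andP[g0 g1] := g01.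
have sq0 (r : R) : 0 < r -> 0 < 1 / 2 * Num.sqrt (r `^ al).
  by move=> r0; rewrite mulr_gt0 ?sqrtr_gt0 ?powR_gt0 // divr_gt0.
(* An angle above 60 degrees has squared sine above [3 / 4], hence [pair_ratio] at least [3 / 4]; so
   [z0] bounds the energy of wide pairs from below. *)
pose z0 : R := 1 / 2 * Num.sqrt ((3 / 4) `^ al).
have z00 : 0 < z0 by apply: sq0; lra.
pose B x y x' y' := z0^-1 * pair_energy al f x y x' y'.
have z0V : 0 < z0^-1 by rewrite invr_gt0.
have Bge0 x y x' y' : 0 <= B x y x' y' by rewrite mulr_ge0 ?sqrtr_ge0 // ltW.
have mC x y x' y' : measurable (cone_set x y x' y' : set (measurableTypeR R)).
  exact: measurable_cone_set.
have ratio_ge x y x' y' (r : R) : 0 < energy_dot E x y x' y' -> 0 <= r ->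
    r <= pair_ratio E x y x' y' ->
    z0^-1 * (1 / 2 * Num.sqrt (r `^ al)) <= B x y x' y'.
  move=> d0 r0 rle; have [n0 n0'] := energy_norm_gt0 E2 d0.
  have /andP[h _] := pair_energy_bounds fb n0 n0'.
  apply: ler_wpM2l; first exact: ltW.
  apply: le_trans h; apply: ler_wpM2l; first lra.
  rewrite ler_wsqrtr // ge0_ler_powR ?nnegrE ?(ltW al0) //.
  exact: le_trans rle.
have far x y x' y' : 0 < energy_dot E x y x' y' ->
    4 * energy_dot E x y x' y' ^+ 2 < energy_norm E x y * energy_norm E x' y' ->
    1 <= B x y x' y'.
  move=> d0 h; have [n0 n0'] := energy_norm_gt0 E2 d0.
  rewrite -(mulVf (lt0r_neq0 z00)); apply: ratio_ge => //.
  rewrite /pair_ratio ler_pdivlMr ?mulr_gt0 //.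
  move: h; rewrite energy_dot_lagrange.
  have := sqr_ge0 (x * y' - y * x'); nra.
(* This is where the absence of atoms enters: a cone either fits into a ball of mass at most [h] or
   has [pair_ratio] bounded below. *)
have small h : 0 < h -> exists2 b, 0 < b & forall x y x' y',
    0 < energy_dot E x y x' y' ->
    mass nu (cone_set x y x' y') <= h \/ b <= B x y x' y'.
  move=> h0.
  have nu0 s : mass nu (line_set (cos s) (sin s)) = 0.
    apply: (mass_line0 l0 nuF); rewrite xpair_eqE; apply/negP => /andP[/eqP c /eqP s'].
    by have := cos2Dsin2 s; rewrite c s' expr0n addr0 => /eqP; rewrite eq_sym oner_eq0.
  have [d d0 dP] := mass_angle_ball_small h0 nu0.
  have d20 : 0 < d ^+ 2 / 4 by rewrite divr_gt0 ?exprn_gt0.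
  exists (z0^-1 * (1 / 2 * Num.sqrt ((d ^+ 2 / 4) `^ al))).
    by rewrite mulr_gt0 // sq0.
  move=> x y x' y' e0; have [n0 n0'] := energy_norm_gt0 E2 e0.
  have [le|lt] := leP (d ^+ 2 / 4) (pair_ratio E x y x' y').
    by right; apply: ratio_ge => //; exact: ltW.
  left.
  have xy0 : (x, y) != (0, 0).
    apply: contraTneq n0 => -[-> ->].
    by rewrite /energy_dot !(mulr0, subr0, addr0) ltxx.
  have [r [s [r0 s0 xE yE]]] := polar_coord xy0.
  apply: le_trans (dP s s0); apply: le_mass => //.
    exact: measurable_angle_ball.
  move=> t /(cone_set_wedge E2 e0); rewrite /angle_ball /=.
  have -> : x * sin t - y * cos t = r * sin (t - s) by rewrite xE yE sinB; ring.
  have r2 : 0 < r ^+ 2 by rewrite exprn_even_gt0.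
  have nr : energy_norm E x y <= 2 * r ^+ 2.
    have -> : energy_norm E x y = r ^+ 2 * energy_norm E (cos s) (sin s).
      by rewrite xE yE /energy_dot; ring.
    by rewrite mulrC ler_pM2r //; exact: energy_norm_circle.
  move: lt; rewrite /pair_ratio ltr_pdivrMr ?mulr_gt0 //.
  set w := (_ - _) ^+ 2; set N := energy_norm E x y in n0 nr *.
  set N' := energy_norm E x' y' in n0' *; set si := sin (t - s) => wlt sile.
  rewrite -(ler_pXn2r (n := 2)) ?nnegrE ?(ltW d0) // real_normK ?num_real //.
  rewrite -(ler_pM2r (mulr_gt0 r2 n0')).
  have dN : d ^+ 2 * (N * N') <= d ^+ 2 * (2 * r ^+ 2 * N').
    by apply: ler_wpM2l; [exact: sqr_ge0 | apply: ler_wpM2r => //; exact: ltW].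
  have -> : si ^+ 2 * (r ^+ 2 * N') = (r * si) ^+ 2 * N' by ring.
  lra.
exists z0^-1 => // X Y X' Y' d0; rewrite -/(B X Y X' Y').
apply/ler_addgt0Pr => h h0.
have [b b0 bP] := small h h0.
(* The added [h] keeps the denominators away from 0, so that the supremum is finite; it tends to 0
   at the end. *)
pose A := [set r | exists x y x' y', 0 < energy_dot E x y x' y' /\
  r = mass nu (cone_set x y x' y') / (B x y x' y' + h)].
have Bh x y x' y' : 0 < B x y x' y' + h by rewrite ltr_wpDl.
have Aub : ubound A h^-1.
  move=> _ [x [y [x' [y' [_ ->]]]]]; rewrite ler_pdivrMr //.
  apply: le_trans (mass_le1 _ (mC _ _ _ _)) _.
  by rewrite mulrDr mulVf ?gt_eqF // lerDr mulr_ge0 // invr_ge0 ltW.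
have hsA : has_sup A.
  split; last by exists h^-1.
  by exists (mass nu (cone_set X Y X' Y') / (B X Y X' Y' + h)), X, Y, X', Y'.
have leN x y x' y' : 0 < energy_dot E x y x' y' ->
    mass nu (cone_set x y x' y') <= sup A * (B x y x' y' + h).
  move=> e0; rewrite -ler_pdivrMr //; apply: sup_upper_bound => //.
  by exists x, y, x', y'.
have N0 : 0 <= sup A.
  have := leN _ _ _ _ d0; have := mass_ge0 nu (cone_set X Y X' Y') => m0 /(le_trans m0).
  by rewrite pmulr_lge0.
suff N1 : sup A <= 1.
  apply: le_trans (leN _ _ _ _ d0) _; apply: ler_piMl => //; exact: ltW.
rewrite leNgt; apply/negP => N1.
(* For [B >= b] the share [B / (B + h)] of the denominator that is contracted is at least
   [b / (b + h)], whence the factor [th]. *)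
pose th := 1 - gamma * (b / (b + h)).
have bh0 : 0 < b + h by rewrite addr_gt0.
have th1 : th < 1 by rewrite ltrBlDr ltrDl mulr_gt0 // divr_gt0.
suff : sup A <= Num.max 1 (sup A * th).
  rewrite le_max leNgt N1 /= leNgt => /negP; apply.
  by rewrite gtr_pMr // (lt_trans ltr01).
apply: ge_sup; first by case: hsA.
move=> _ [x [y [x' [y' [e0 ->]]]]]; rewrite le_max !ler_pdivrMr // mul1r.
have Bxy0 := Bge0 x y x' y'.
(* Wide pairs and cones of mass at most [h] have quotient at most 1. For the remaining pairs both
   images are acute, so [sup A] bounds their quotients and the mean inequality gains [th]. *)
have [lt|le] := ltP (4 * energy_dot E x y x' y' ^+ 2)
                    (energy_norm E x y * energy_norm E x' y').
  apply/orP; left; apply: le_trans (mass_le1 _ (mC _ _ _ _)) _.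
  by have := far _ _ _ _ e0 lt; lra.
have [mh|bB] := bP _ _ _ _ e0; first by apply/orP; left; lra.
apply/orP; right.
have [n0 n0'] := energy_norm_gt0 E2 e0.
have step t : t ^+ 2 = lambda ^+ 2 ->
    0 < energy_dot E y ((E + t) * y - x) y' ((E + t) * y' - x').
  by move=> tl; apply: energy_dot_step => //; rewrite tl.
have m1 := leN _ _ _ _ (step (- lambda) (sqrrN _)).
have m2 := leN _ _ _ _ (step lambda erefl).
have mm := mass_cone_mean nuF x y x' y'.
have em := pair_energy_mean al fm g01 f0 n0 n0'.
have := ler_wpM2l (ltW z0V) em; rewrite mulrDr -!/(B _ _ _ _) => {}em.
have em' : B y ((E - lambda) * y - x) y' ((E - lambda) * y' - x') +
  B y ((E + lambda) * y - x) y' ((E + lambda) * y' - x') <=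
  2 * ((1 - gamma) * B x y x' y').
  by apply: le_trans em _; rewrite /B; lra.
have bnd : 2 * mass nu (cone_set x y x' y') <=
   sup A * (2 * ((1 - gamma) * B x y x' y') + 2 * h).
  rewrite mm; apply: le_trans (lerD m1 m2) _; rewrite -mulrDr.
  by apply: ler_wpM2l => //; lra.
have key : (1 - gamma) * B x y x' y' + h <= th * (B x y x' y' + h).
  rewrite -subr_ge0.
  have -> : th * (B x y x' y' + h) - ((1 - gamma) * B x y x' y' + h) =
     gamma * h / (b + h) * (B x y x' y' - b).
    by rewrite /th; field; rewrite gt_eqF.
  by rewrite mulr_ge0 ?subr_ge0 // divr_ge0 ?mulr_ge0 // ltW.
rewrite -mulrA; apply: le_trans (ler_wpM2l N0 key); lra.
Qed.

(** The weight is used with the rotation of cosine [E / 2] and sine [S], shear parameter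
    [lambda / S] and [eta = C * lambda]. Both [|E| / 2] and [S] are at least [delta0 / 2], which
    makes [C] independent of [E]. *)
Lemma furstenberg_cone_mass (R : realType) (delta0 : R) : 0 < delta0 < 1 ->
  exists2 C : R, 0 < C & forall lambda E : R, 0 < lambda -> C * lambda < 1 / 2 ->
    delta0 < `|E| < 2 - delta0 -> forall nu : probability (measurableTypeR R) R,
    furstenberg_measure E lambda nu ->
    exists2 K : R, 0 < K & forall x y x' y', 0 < energy_dot E x y x' y' ->
      mass nu (cone_set x y x' y') <=
      K * Num.sqrt (pair_ratio E x y x' y' `^ (1 - C * lambda)).
Proof.
move=> /andP[d0 d1]; set sigma := delta0 / 2.
have sg0 : 0 < sigma by rewrite /sigma; lra.
have sg1 : sigma <= 1 by rewrite /sigma; lra.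
have sg01 : 0 < sigma <= 1 by rewrite sg0 sg1.
have [C0 C00 C0P] := weight_superharmonic sg01.
have C1 : 0 < C0 / sigma by rewrite divr_gt0.
have C2 : 0 < 4 / sigma by rewrite divr_gt0.
(* The first summand gives [C0 * (lambda / S) <= C * lambda]; the second, with [C * lambda < 1 / 2],
   gives [4 * lambda <= S], as needed to keep pairs acute. *)
exists (C0 / sigma + 4 / sigma); first by rewrite addr_gt0.
set C := C0 / sigma + 4 / sigma => lambda E l0 lC /andP[E1 E2] nu nuF.
have El2 : `|E| < 2 by lra.
have /andP[k0 k1] := energy_coef El2.
set S := Num.sqrt (1 - E ^+ 2 / 4).
have S0 : 0 < S by rewrite sqrtr_gt0.
have SE : S ^+ 2 = 1 - E ^+ 2 / 4 by rewrite sqr_sqrtr // ltW.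
have nE : `|E| ^+ 2 = E ^+ 2 by rewrite real_normK ?num_real.
have E2' : E ^+ 2 <= 2 * `|E| by rewrite -nE expr2 ler_wpM2r // ltW.
have sS : sigma <= S.
  rewrite -(ler_pXn2r (n := 2)) ?nnegrE ?ltW // SE.
  have : sigma ^+ 2 <= sigma by rewrite expr2 ger_pMl.
  by rewrite /sigma; lra.
have lsig : 4 / sigma * lambda <= 1 / 2.
  have : 0 <= C0 / sigma * lambda by rewrite mulr_ge0 // ltW.
  by move: lC; rewrite /C; lra.
have l4 : 4 * lambda <= S.
  have : 4 * lambda <= sigma / 2.
    by move: lsig; rewrite mulrAC ler_pdivrMr //; lra.
  lra.
have cs : (E / 2) ^+ 2 + S ^+ 2 = 1 by rewrite SE; field.
have sc : sigma <= `|E / 2|.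
  by rewrite normrM normfV (ger0_norm (ler0n _ 2)) /sigma; lra.
have ss : sigma <= `|S| by rewrite ger0_norm // ltW.
have e0 : 0 < lambda / S by rewrite divr_gt0.
have Ce : C0 * (lambda / S) <= C * lambda.
  apply: le_trans (_ : C0 / sigma * lambda <= _).
    rewrite mulrA mulrAC; apply: ler_wpM2r; first exact: ltW.
    by apply: ler_wpM2l; rewrite ?lef_pV2 ?posrE // ltW.
  by rewrite /C; apply: ler_wpM2r; [exact: ltW | rewrite lerDl ltW].
have [gamma [F [g01 F0 Fb Fm]]] := C0P _ _ _ _ cs sc ss e0 Ce lC.
pose f x y := F (S * x) (y - E / 2 * x).
have NE x y : energy_norm E x y = (S * x) ^+ 2 + (y - E / 2 * x) ^+ 2.
  by rewrite exprMn SE /energy_dot; ring.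
have al0 : 0 < 1 - C * lambda by lra.
have fb x y : 0 < energy_norm E x y ->
    1 / 2 * energy_norm E x y `^ (- (1 - C * lambda)) <= f x y <=
    2 * energy_norm E x y `^ (- (1 - C * lambda)).
  by rewrite NE => /Fb.
have fm x y : 0 < energy_norm E x y ->
    f y ((E - lambda) * y - x) + f y ((E + lambda) * y - x) <=
    2 * ((1 - gamma) * f x y).
  rewrite NE => /Fm /=; rewrite /f.
  have -> : E / 2 * (S * x) + S * (y - E / 2 * x) = S * y by ring.
  have -> : E / 2 * (y - E / 2 * x) - S * (S * x) = E / 2 * y - x.
    have -> : S * (S * x) = S ^+ 2 * x by ring.
    by rewrite SE; field.
  have -> : lambda / S * (S * y) = lambda * y by field; rewrite gt_eqF.
  have -> : (E - lambda) * y - x - E / 2 * y = E / 2 * y - x - lambda * y by field.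
  have -> : (E + lambda) * y - x - E / 2 * y = E / 2 * y - x + lambda * y by field.
  by rewrite addrC.
have l16 : 16 * lambda ^+ 2 <= 1 - E ^+ 2 / 4.
  by rewrite -SE; nra.
have [K K0 KP] := cone_mass_le El2 l0 l16 al0 g01 (fun x y => F0 _ _) fb fm nuF.
exists (K * 2); first by rewrite mulr_gt0.
move=> x y x' y' dot0; apply: le_trans (KP _ _ _ _ dot0) _.
have [n0 n0'] := energy_norm_gt0 El2 dot0.
have /andP[_ h] := pair_energy_bounds fb n0 n0'.
by rewrite -mulrA; apply: ler_wpM2l h; exact: ltW.
Qed.

(** * From cones to arcs *)

Lemma cos_sin_shift (R : realType) (n : int) (x : R) :
  exists2 e : R, e ^+ 2 = 1 &
    cos (x - n%:~R * pi) = e * cos x /\ sin (x - n%:~R * pi) = e * sin x.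
Proof.
have nat_shift (k : nat) (y : R) : exists2 e : R, e ^+ 2 = 1 &
    cos (y + k%:R * pi) = e * cos y /\ sin (y + k%:R * pi) = e * sin y.
  elim: k => [|k [e e1 [ec es]]].
    by exists 1; rewrite ?expr1n // mul0r addr0 !mul1r.
  exists (- e); rewrite ?sqrrN //.
  by rewrite -addn1 natrD mulrDl mul1r addrA cosDpi sinDpi ec es !mulNr.
case: n => k.
  have [e e1 [ec es]] := nat_shift k (x - k%:R * pi).
  rewrite subrK in ec es; exists e => //.
  by rewrite ec es !mulrA -expr2 e1 !mul1r.
have [e e1 [ec es]] := nat_shift k.+1 x; exists e => //.
by rewrite NegzE mulrNz mulNr opprK.
Qed.

Lemma circle_proj_image_cone (R : realType) (J : set R) (a b : R) :
  b - a <= pi -> J `<=` `[a, b]%classic ->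
  circle_proj (R := R) @` J `<=` cone_set (cos a) (sin a) (cos b) (sin b).
Proof.
move=> ab Jab _ [x /Jab + <-]; rewrite /= in_itv /= => /andP[ax xb].
rewrite /cone_set /circle_proj /=; set n := Num.floor _.
have [e e1 [-> ->]] := cos_sin_shift n x.
have -> : (cos a * (e * sin x) - sin a * (e * cos x)) *
  (sin b * (e * cos x) - cos b * (e * sin x)) =
  e ^+ 2 * (sin (x - a) * sin (b - x)) by rewrite !sinB; ring.
by rewrite e1 mul1r mulr_ge0 // sin_ge0_pi //; apply/andP; split; lra.
Qed.

(** The inner product equals [cos (b - a) - E / 2 * sin (a + b)], which is at least
    [1 - (b - a) ^+ 2 / 2 - |E| / 2]. *)
Lemma energy_dot_circle_gt0 (R : realType) (E a b : R) : `|E| < 2 ->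
  `|b - a| <= 1 - `|E| / 2 -> 0 < energy_dot E (cos a) (sin a) (cos b) (sin b).
Proof.
move=> E2 ab; have E0 := normr_ge0 E.
have -> : energy_dot E (cos a) (sin a) (cos b) (sin b) =
  cos (b - a) - E / 2 * sin (a + b).
  by rewrite /energy_dot cosB sinD; field.
have h : - (`|E| / 2) <= - (E / 2 * sin (a + b)).
  rewrite lerN2; apply: le_trans (ler_norm _) _.
  rewrite normrM normrM normfV (ger0_norm (ler0n _ 2)) ler_piMr //.
  exact: sin_max.
have c : 1 - (b - a) ^+ 2 / 2 <= cos (b - a).
  have -> : cos (b - a) = cos ((b - a) / 2) ^+ 2 - sin ((b - a) / 2) ^+ 2.
    by rewrite {1}[b - a]splitr cosD -!expr2.
  have := cos2Dsin2 ((b - a) / 2).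
  have : sin ((b - a) / 2) ^+ 2 <= ((b - a) / 2) ^+ 2.
    rewrite -real_normK ?num_real // -[leRHS]real_normK ?num_real //.
    by rewrite ler_pXn2r ?nnegrE // normr_sin_le.
  lra.
have sq : (b - a) ^+ 2 <= 1 - `|E| / 2.
  rewrite -real_normK ?num_real //.
  have := normr_ge0 (b - a); nra.
lra.
Qed.

Lemma energy_norm_circle_ge (R : realType) (E t : R) :
  1 - `|E| / 2 <= energy_norm E (cos t) (sin t).
Proof.
have -> : energy_norm E (cos t) (sin t) =
  cos t ^+ 2 + sin t ^+ 2 - E * (cos t * sin t) by rewrite /energy_dot; field.
rewrite cos2Dsin2 lerD2l lerN2; apply: le_trans (ler_norm _) _; rewrite normrM.
apply: ler_wpM2l => //; rewrite ler_norml.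
have := cos2Dsin2 t; have := sqr_ge0 (cos t - sin t).
have := sqr_ge0 (cos t + sin t); rewrite !expr2 => h1 h2 h3.
by apply/andP; split; nra.
Qed.

(** An arc is the part in the fundamental domain of the union of the translates of [J] by multiples
    of [pi]; [P] and [N] collect the two signs so that the unions run over naturals. *)
Lemma arc_measurable (R : realType) (I : set R) : is_arc I ->
  measurable (I : set (measurableTypeR R)).
Proof.
move=> [J [iJ ->]].
pose P (n : nat) := [set t : R | J (t + n%:R * pi)].
pose N (n : nat) := [set t : R | J (t - n%:R * pi)].
have -> : circle_proj (R := R) @` J = circle R `&` (\bigcup_n P n `|` \bigcup_n N n).
  apply/seteqP; split => [_ [x Jx <-]|t [ct]].
    split; first exact: circle_proj_in.
    rewrite /circle_proj; case: (Num.floor _) => n.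
      by left; exists n => //; rewrite /P /= subrK.
    by right; exists n.+1 => //; rewrite /N /= NegzE mulrNz mulNr opprK addrK.
  have ex (n : int) : J (t + n%:~R * pi) -> (circle_proj (R := R) @` J) t.
    move=> h; exists (t + n%:~R * pi) => //; rewrite /circle_proj.
    have -> : Num.floor ((t + n%:~R * pi) / pi) = n; last by rewrite addrK.
    have p0 := @pi_gt0 R.
    move: ct; rewrite /circle /= in_itv /= => /andP[t0 tp].
    apply/floor_def; rewrite ler_pdivlMr // ltr_pdivrMr // intrD mulrDl mul1r.
    by apply/andP; split; lra.
  case=> -[n _ h]; first exact: (ex n).
  by apply: (ex (- n%:Z)); rewrite mulrNz mulNr.
have mi (c : R) : measurable ([set t | J (t + c)] : set (measurableTypeR R)).
  apply: is_interval_measurable => x y /= Jx Jy z /andP[xz zy].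
  by apply: (iJ _ _ Jx Jy); rewrite !lerD2r xz zy.
apply: measurableI; first exact: measurable_itv.
apply: measurableU; apply: bigcupT_measurable => n; first exact: mi.
exact: (mi (- _)).
Qed.

Lemma circle_proj_shift (R : realType) (n : int) (x : R) :
  n%:~R * pi <= x < (n + 1)%:~R * pi -> circle_proj x = x - n%:~R * pi.
Proof.
move=> h; rewrite /circle_proj; have -> // : Num.floor (x / pi) = n.
by apply/floor_def; rewrite ler_pdivlMr ?pi_gt0 // ltr_pdivrMr ?pi_gt0.
Qed.

(** The period containing the midpoint [m] contains [[x, m]] or [[m, y[], since the whole interval
    has length at most [pi]. On that period the projection is a translation, so half of the length
    survives. *)
Lemma arc_length_ge (R : realType) (J : set R) (x y : R) :
  is_interval J -> J x -> J y -> x <= y -> y - x <= pi ->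
  (((y - x) / 2)%:E <= @lebesgue_measure R (circle_proj (R := R) @` J))%E.
Proof.
move=> iJ Jx Jy xy yxpi; have p0 := @pi_gt0 R.
set m := (x + y) / 2; set n := Num.floor (m / pi).
have /andP[nm mn] : n%:~R * pi <= m < (n + 1)%:~R * pi.
  by rewrite -ler_pdivlMr // -ltr_pdivrMr // floor_itv.
have n1 : (n + 1)%:~R * pi = n%:~R * pi + pi :> R by rewrite intrD mulrDl mul1r.
have half u v : n%:~R * pi <= u -> v <= (n + 1)%:~R * pi -> x <= u -> v <= y ->
    ((v - u)%:E <= @lebesgue_measure R (circle_proj (R := R) @` J))%E.
  move=> nu vn xu vy.
  have [vu|uv] := leP v u.
    by apply: (@le_trans _ _ 0%E) => //; rewrite lee_fin subr_le0.
  have := @lebesgue_measure_itv R `[u - n%:~R * pi, v - n%:~R * pi[.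
  rewrite /= lte_fin ltrD2r uv -EFinB.
  have -> : v - n%:~R * pi - (u - n%:~R * pi) = v - u by ring.
  move=> <-; apply: le_measure.
  - by apply: mem_set; exact: measurable_itv.
  - by apply: mem_set; apply: arc_measurable; exists J.
  move=> t /=; rewrite in_itv /= => /andP[t1 t2].
  exists (t + n%:~R * pi).
    by apply: (iJ _ _ Jx Jy); apply/andP; split; lra.
  by rewrite (@circle_proj_shift _ n) ?addrK //; apply/andP; split; lra.
have [xn|nx] := leP (n%:~R * pi) x.
  have -> : (y - x) / 2 = m - x by rewrite /m; field.
  by apply: half => //; [exact: ltW | rewrite /m; lra].
have -> : (y - x) / 2 = y - m by rewrite /m; field.
by apply: half => //; [rewrite n1; lra | rewrite /m; lra].
Qed.

Lemma lebesgue_arc_fin (R : realType) (I : set R) : is_arc I ->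
  exists2 l : R, 0 <= l & @lebesgue_measure R I = l%:E.
Proof.
move=> aI; have mI := arc_measurable aI.
have le_pi : (@lebesgue_measure R I <= pi%:E)%E.
  have := @lebesgue_measure_itv R `[0, pi[.
  rewrite /= lte_fin pi_gt0 sube0 => <-.
  apply: le_measure; [exact: mem_set | by apply: mem_set; exact: measurable_itv |].
  by move: aI => [J [_ ->]] _ [x _ <-]; exact: circle_proj_in.
have fin : (@lebesgue_measure R I) \is a fin_num.
  by rewrite ge0_fin_numE // (le_lt_trans le_pi) // ltry.
exists (fine (@lebesgue_measure R I)); last by rewrite fineK.
exact: fine_ge0.
Qed.

Lemma arc_mass_le (R : realType) (E al K : R)
    (nu : probability (measurableTypeR R) R) :
  `|E| < 2 -> 0 < al -> 0 < K ->
  (forall x y x' y', 0 < energy_dot E x y x' y' ->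
    mass nu (cone_set x y x' y') <=
    K * Num.sqrt (pair_ratio E x y x' y' `^ al)) ->
  exists C : R, forall I : set R, is_arc I ->
    (nu I <= C%:E * (@lebesgue_measure R I) `^ al)%E.
Proof.
move=> E2 al0 K0 KP; set k := 1 - `|E| / 2.
have k0 : 0 < k by rewrite /k; lra.
have k1 : k <= 1 by rewrite /k; have := normr_ge0 E; lra.
have p2 : 2 <= @pi R by exact: pi_ge2.
(* The first term covers arcs with [8 * l >= k], whose mass is bounded by 1; the second covers the
   shorter ones through a cone. *)
exists ((8 / k) `^ al + K * (4 / k) `^ al) => I aI.
have [l l0 lE] := lebesgue_arc_fin aI.
have mI := arc_measurable aI.
rewrite lE poweR_EFin -EFinM massE // lee_fin mulrDl.
have l8 : 0 <= 8 / k by rewrite divr_ge0 // ltW.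
have l4 : 0 <= 4 / k by rewrite divr_ge0 // ltW.
have t1 : 0 <= (8 / k) `^ al * l `^ al by rewrite mulr_ge0 // powR_ge0.
have t2 : 0 <= K * (4 / k) `^ al * l `^ al.
  by rewrite mulr_ge0 ?mulr_ge0 ?powR_ge0 // ltW.
have [big|small] := leP k (8 * l).
  apply: le_trans (mass_le1 _ mI) _; apply: ler_wpDr => //.
  rewrite -powRM //; apply: (@le_trans _ _ (1 `^ al)); first by rewrite powR1.
  rewrite ge0_ler_powR ?nnegrE ?(ltW al0) ?(mulr_ge0 l8) //.
  by rewrite mulrAC ler_pdivlMr // mul1r.
apply: ler_wpDl => //.
have [J [iJ IE]] := aI.
have close x y : J x -> J y -> x <= y -> y - x <= 2 * l.
  move=> Jx Jy xy; have [yx|yx] := leP (y - x) pi.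
    have := arc_length_ge iJ Jx Jy xy yx.
    by rewrite -IE lE lee_fin; lra.
  (* Here [J] would contain an interval of length [pi], forcing [l >= pi / 2], against
     [8 * l < k <= 1]. *)
  have Jy' : J (x + pi) by apply: (iJ _ _ Jx Jy); apply/andP; split; lra.
  have := @arc_length_ge _ J x (x + pi) iJ Jx Jy'.
  by rewrite -IE lE lee_fin addrAC subrr add0r => h; have := h _ _; lra.
have [[x0 Jx0]|J0] := pselect (exists x, J x); last first.
  have -> : I = set0.
    by rewrite IE; apply/seteqP; split => // y [x Jx _]; apply: J0; exists x.
  by rewrite /mass measure0.
set a := x0 - 2 * l; set b := x0 + 2 * l.
have Jab : J `<=` `[a, b]%classic.
  move=> x Jx; rewrite /= in_itv /= /a /b.
  have [xx|/ltW xx] := leP x x0.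
    by have := close _ _ Jx Jx0 xx => h; apply/andP; split; lra.
  by have := close _ _ Jx0 Jx xx => h; apply/andP; split; lra.
have ba : b - a = 4 * l by rewrite /a /b; ring.
have dot0 : 0 < energy_dot E (cos a) (sin a) (cos b) (sin b).
  by apply: energy_dot_circle_gt0 => //; rewrite ba ger0_norm -/k; lra.
have Icone : I `<=` cone_set (cos a) (sin a) (cos b) (sin b).
  by rewrite IE; apply: circle_proj_image_cone => //; rewrite ba; lra.
apply: le_trans (le_mass nu mI (measurable_cone_set _ _ _ _) Icone) _.
apply: le_trans (KP _ _ _ _ dot0) _.
rewrite -mulrA; apply: ler_wpM2l; first exact: ltW.
rewrite -powRM //.
have q0 : 0 <= 4 / k * l by rewrite mulr_ge0.
have -> : (4 / k * l) `^ al = Num.sqrt (((4 / k * l) ^+ 2) `^ al).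
  have -> : ((4 / k * l) ^+ 2) `^ al = ((4 / k * l) `^ al) ^+ 2.
    by rewrite !expr2 powRM.
  by rewrite sqrtr_sqr ger0_norm // powR_ge0.
have na : k <= energy_norm E (cos a) (sin a) by exact: energy_norm_circle_ge.
have nb : k <= energy_norm E (cos b) (sin b) by exact: energy_norm_circle_ge.
have nab : k ^+ 2 <= energy_norm E (cos a) (sin a) * energy_norm E (cos b) (sin b).
  by rewrite expr2; apply: ler_pM => //; exact: ltW.
have nab0 : 0 < energy_norm E (cos a) (sin a) * energy_norm E (cos b) (sin b).
  by apply: lt_le_trans nab; rewrite exprn_gt0.
rewrite ler_wsqrtr // ge0_ler_powR ?nnegrE ?(ltW al0) ?sqr_ge0 //.
  by rewrite /pair_ratio divr_ge0 ?sqr_ge0 // ltW.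
rewrite /pair_ratio ler_pdivrMr //.
have -> : cos a * sin b - sin a * cos b = sin (b - a) by rewrite sinB; ring.
have s2 : sin (b - a) ^+ 2 <= (4 * l) ^+ 2.
  rewrite -real_normK ?num_real // ler_pXn2r ?nnegrE //; last by lra.
  by apply: le_trans (normr_sin_le _) _; rewrite ba ger0_norm; lra.
apply: le_trans s2 _.
have -> : (4 * l) ^+ 2 = (4 / k * l) ^+ 2 * k ^+ 2.
  by field; rewrite gt_eqF.
by apply: ler_wpM2l => //; exact: sqr_ge0.
Qed.

Theorem theorem1 (R : realType) (delta0 : R) (hdelta0 : 0 < delta0 < 1) :
  exists (lambda0 : R) (alpha : R -> R),
    [/\ 0 < lambda0,
        forall lambda : R, 0 < lambda < lambda0 -> 0 < alpha lambda <= 1,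
        alpha x @[x --> 0^'+] --> (1 : R)
      & forall lambda E : R, 0 < lambda < lambda0 ->
          delta0 < `|E| < 2 - delta0 ->
          forall nu : probability (measurableTypeR R) R,
            furstenberg_measure E lambda nu ->
            ((alpha lambda)%:E <= measure_dim nu)%E].
Proof.
have [C C0 CP] := furstenberg_cone_mass hdelta0.
have small lambda : 0 < lambda < (2 * C)^-1 -> 0 < C * lambda < 1 / 2.
  move=> /andP[l0 l1]; rewrite mulr_gt0 //=.
  by move: l1; rewrite -[_^-1]mul1r ltr_pdivlMr ?mulr_gt0 //; lra.
(* Below this threshold [C * lambda] stays under [1 / 2], the range allowed for [eta]. *)
exists (2 * C)^-1, (fun lambda => 1 - C * lambda); split.
- by rewrite invr_gt0 mulr_gt0.
- by move=> lambda /small /andP[h1 h2]; apply/andP; split; lra.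
- apply/cvgrPdist_lt => e e0; near=> x.
  have -> : 1 - (1 - C * x) = C * x by ring.
  have x0 : 0 < x by near: x; exact: nbhs_right_gt.
  rewrite ger0_norm ?mulr_ge0 ?ltW // mulrC -ltr_pdivlMr //.
  by near: x; apply: nbhs_right_lt; rewrite divr_gt0.
move=> lambda E lambda_small hE nu nuF.
have /andP[l0 _] := lambda_small; have /andP[_ Cl] := small _ lambda_small.
have [K K0 KP] := CP lambda E l0 Cl hE nu nuF.
have E2 : `|E| < 2 by move: hdelta0 hE => /andP[? ?] /andP[? ?]; lra.
have al0 : 0 < 1 - C * lambda by lra.
apply: ereal_sup_ubound; exists (1 - C * lambda) => //; split; first exact: ltW.
exact: arc_mass_le E2 al0 K0 KP.
Unshelve. all: by end_near.
Qed.
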